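(* Let $\mathbb K$ be a field of characteristic zero, let $A$ be a commutative associative $\mathbb K$-algebra with identity which is an integral domain, let $R$ be the quotient field of $A$, and let $W(A)=R\,\mathrm{Der}\,A$. Let $L$ be a solvable $\mathbb K$-subalgebra of $W(A)$ which is maximal (by inclusion) among all solvable subalgebras of rank $2$ over $R$ of $W(A)$, and let $F=F(L)$ be its field of constants. Then $L$ is a Lie algebra over $F$, the algebra $L$ contains elements $D_1,D_2$ with $[D_2,D_1]=aD_1$ for some $a\in F_1=\ker D_1$, and $L$ is one of the following algebras over the field $F$: 1. $L=\langle D_2\rangle\rightthreetimes F_1D_1$. 2. $L=\langle D_2\rangle\rightthreetimes(F_1D_1+bF_1D_1)$, where $b\in R$, $D_1(b)=1$, $D_2(b)=ab+a_1$ for some $a_1\in F_1$. 3. $L=(\langle cD_1+dD_2\rangle\rightthreetimes\langle D_2\rangle)\rightthreetimes F_1D_1$, where $c\in R$, $d\in F_1$ are such that $D_1(c)\in F_1$, $D_2(d)=1$, $D_2(c)=-ac+r$ for some $r\in F_1$. 4. $L=(\langle cD_1+dD_2\rangle\rightthreetimes\langle D_2\rangle)\rightthreetimes(F_1D_1+F_1bD_1)$, where $b,c\in R$, $D_1(b)=1$, $D_2(d)=1$, $d\in F_1$, $D_1(c)\in F_1$, $D_2(c)=-ac+r$, $D_2(b)=ab+a_1$ for some $r,a_1\in F_1$. 5. $L$ is isomorphic to a solvable subalgebra of the affine Lie algebra $ga_2(F)$ containing $F^2$; in particular $2\le\dim_F L\le 5$.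
   Context: $\mathrm{Der}\,A$ denotes the Lie algebra of all $\mathbb K$-derivations of $A$; it is an $A$-module via $(aD)(x)=a\cdot D(x)$. Every derivation of $A$ extends uniquely to a derivation of the quotient field $R$, so $W(A)=R\,\mathrm{Der}\,A$ (the set of all $R$-linear combinations of such extended derivations) is a $\mathbb K$-Lie subalgebra of $\mathrm{Der}\,R$ and a vector space over $R$ (it is not in general a Lie algebra over $R$). Subalgebras of $W(A)$ are $\mathbb K$-subalgebras. For a subalgebra $L\subseteq W(A)$: $RL$ is the $R$-span of $L$ and the rank of $L$ over $R$ is $\mathrm{rk}_R L=\dim_R RL$; the field of constants of $L$ is $F(L)=\{r\in R \mid D(r)=0 \text{ for all } D\in L\}$, a subfield of $R$; $\ker D_1=\{r\in R\mid D_1(r)=0\}$, a subfield of $R$ containing $F$. $\langle D\rangle$ denotes the $F$-span of $D$; $F_1D_1=\{fD_1\mid f\in F_1\}$ and $bF_1D_1=F_1bD_1=\{fbD_1\mid f\in F_1\}$. $L=B\rightthreetimes N$ denotes the semidirect sum: $N$ is an ideal of $L$, $B$ is a subalgebra of $L$, $L=N+B$, $N\cap B=0$. $ga_2(F)=gl_2(F)\rightthreetimes F^2$ is the general affine Lie algebra, of dimension $6$ over $F$, where $F^2$ is the abelian ideal of translations on which $gl_2(F)$ acts naturally. *)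

(* Defs.v *)
From HB Require Import structures.
From mathcomp Require Import all_boot all_algebra.
From mathcomp Require Import boolp classical_sets functions.

Set Implicit Arguments.
Unset Strict Implicit.
Unset Printing Implicit Defensive.

Import GRing.Theory.
Local Open Scope classical_set_scope.
Local Open Scope ring_scope.

#[short(type="idomainAlgType")]
HB.structure Definition IdomainAlgebra (K : fieldType) :=
  { A of GRing.ComUnitAlgebra K A & GRing.IntegralDomain A }.

(* Every Lie algebra below sits inside a vector space V over the large field R,
   and is linear over some subfield C of R, given as a subset of R. *)
Section LinearAlgebraOverSubfield.
Variables (R : fieldType) (V : lmodType R) (C : set R).

Definition subspace (U : set V) : Prop :=
  [/\ U 0, forall x y, U x -> U y -> U (x + y)
    & forall c x, C c -> U x -> U (c *: x)].

Definition span (X : set V) : set V :=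
  [set v | exists n (c : 'I_n -> R) (x : 'I_n -> V),
    [/\ forall i, C (c i), forall i, X (x i) & v = \sum_(i < n) c i *: x i]].

Definition lin_indep n (e : 'I_n -> V) : Prop :=
  forall c : 'I_n -> R, (forall i, C (c i)) ->
    \sum_(i < n) c i *: e i = 0 -> forall i, c i = 0.

Definition has_dim (U : set V) (n : nat) : Prop :=
  exists e : 'I_n -> V, lin_indep e /\ U = span (range e).

End LinearAlgebraOverSubfield.

Definition sumset (V : nmodType) (M N : set V) : set V :=
  [set x + y | x in M & y in N].

Section LieAlgebraOverSubfield.
Variables (R : fieldType) (V : lmodType R) (C : set R) (br : V -> V -> V).

Definition lie_subalgebra (L : set V) : Prop :=
  subspace C L /\ forall x y, L x -> L y -> L (br x y).

(* The clauses are, in order: C-linearity of the bracket in each argument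
   (additivity and homogeneity at once), alternation, the Jacobi identity. *)
Definition is_lie_algebra (L : set V) : Prop :=
  [/\ lie_subalgebra L,
      forall c x y z, C c -> L x -> L y -> L z ->
        br (c *: x + y) z = c *: br x z + br y z,
      forall c x y z, C c -> L x -> L y -> L z ->
        br z (c *: x + y) = c *: br z x + br z y,
      forall x, L x -> br x x = 0
    & forall x y z, L x -> L y -> L z ->
        br x (br y z) + br y (br z x) + br z (br x y) = 0].

Definition lie_ideal (L N : set V) : Prop :=
  [/\ N `<=` L, subspace C N & forall x y, L x -> N y -> N (br x y)].

Definition derived (L : set V) : set V :=
  span C [set br x y | x in L & y in L].

Definition lie_solvable (L : set V) : Prop :=
  exists n, iter n derived L = [set 0].

Definition semidirect (L B N : set V) : Prop :=
  [/\ lie_ideal L N, lie_subalgebra B, B `<=` L, L = sumset N B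
    & N `&` B = [set 0]].

End LieAlgebraOverSubfield.

Definition lie_isomorphic (R : fieldType) (V V' : lmodType R) (C : set R)
    (br : V -> V -> V) (br' : V' -> V' -> V') (L : set V) (L' : set V') : Prop :=
  exists phi : V -> V',
    [/\ set_bij L L' phi,
        forall x y, L x -> L y -> phi (x + y) = phi x + phi y,
        forall c x, C c -> L x -> phi (c *: x) = c *: phi x
      & forall x y, L x -> L y -> phi (br x y) = br' (phi x) (phi y)].

(* For a subfield F of R, ga_2(F) is realized inside 'M[R]_2 * 'cV[R]_2 as the
   pairs (M, v) with all entries in F; gl_2 acts on translations by M *m v. *)
Section AffineLieAlgebra.
Variables (R : fieldType) (F : set R).

Definition ga2_bracket (x y : 'M[R]_2 * 'cV[R]_2) : 'M[R]_2 * 'cV[R]_2 :=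
  (x.1 *m y.1 - y.1 *m x.1, x.1 *m y.2 - y.1 *m x.2).

Definition ga2 : set ('M[R]_2 * 'cV[R]_2) :=
  [set x : 'M[R]_2 * 'cV[R]_2 |
    (forall i j, F (x.1 i j)) /\ (forall i j, F (x.2 i j))].

Definition ga2_translations : set ('M[R]_2 * 'cV[R]_2) :=
  ga2 `&` [set x | x.1 = 0].

End AffineLieAlgebra.

Definition is_derivation (K S : comNzRingType) (iota : K -> S) (D : S -> S) : Prop :=
  [/\ forall x y, D (x + y) = D x + D y,
      forall k x, D (iota k * x) = iota k * D x
    & forall x y, D (x * y) = D x * y + x * D y].

(* The codomain R^o makes the functions from R to R a vector space over R
   for the pointwise action (r *: D) x = r * D x. *)
Notation fracEnd A := ({fraction A} -> {fraction A}^o).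

Section DerivationsOfFractions.
Variables (K : fieldType) (A : idomainAlgType K).
Local Notation R := {fraction A}.

Definition K_to_frac (k : K) : R := tofrac (k%:A : A).

Definition bracket (D E : fracEnd A) : fracEnd A :=
  fun x => D (E x) - E (D x).

Definition derA_ext : set (fracEnd A) :=
  [set D | is_derivation K_to_frac D /\
    exists d : A -> A, is_derivation (fun k : K => k%:A) d /\
      forall x : A, D (tofrac x) = tofrac (d x)].

Definition WA : set (fracEnd A) := span setT derA_ext.

Definition K_scalars : set R := range K_to_frac.

Definition constants (L : set (fracEnd A)) : set R :=
  [set r | forall D, L D -> D r = 0].

Definition der_ker (D : fracEnd A) : set R := [set r | D r = 0].

Definition has_rank (L : set (fracEnd A)) (n : nat) : Prop :=
  has_dim setT (span setT L) n.

Definition solvable_subalgebra_of_rank (n : nat) (L : set (fracEnd A)) : Prop :=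
  [/\ L `<=` WA, lie_subalgebra K_scalars bracket L,
      lie_solvable K_scalars bracket L & has_rank L n].

Definition maximal_solvable_of_rank (n : nat) (L : set (fracEnd A)) : Prop :=
  solvable_subalgebra_of_rank n L /\
  forall M, solvable_subalgebra_of_rank n M -> L `<=` M -> M = L.

Definition multiples (S : set R) (D : fracEnd A) : set (fracEnd A) :=
  [set f *: D | f in S].

End DerivationsOfFractions.

(* Main.v *)
Require Import Defs.
From HB Require Import structures.
From mathcomp Require Import all_boot all_algebra.
From mathcomp Require Import boolp classical_sets functions.
From mathcomp Require Import ring.

Set Implicit Arguments.
Unset Strict Implicit.
Unset Printing Implicit Defensive.

Import GRing.Theory.
Local Open Scope classical_set_scope.
Local Open Scope ring_scope.

(** Write [F] for the constants of [L] and [RL] for its span over [R]. Everything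
    rests on two consequences of maximality. First, the [F]-span of [L] is a
    solvable algebra with the same [R]-span, so [L] is an algebra over [F]
    ([maximal_subspace]). Second, a solvable subalgebra of [RL] that [L]
    normalizes is contained in [L] ([maximal_absorbs]), since its sum with [L]
    is again solvable.

    The last nonzero term [I] of the derived series of [L] is an abelian ideal.
    If [I] contains two [R]-independent elements [D_0] and [D_1], then [L] looks
    like an algebra of affine vector fields: for [T = x_0 D_0 + x_1 D_1] in [L]
    the brackets of [T] with [D_0] and [D_1] lie in [I], whose elements have
    coordinates in [F], so all [D_j x_i] are in [F]. Sending [T] to the negative
    of its Jacobian matrix and to the values of [x_0, x_1] at a formal base point
    ([base_point]) embeds [L] into [ga_2(F)]. The kernel of the linear part has
    dimension 2 and the linear part cannot contain [sl_2]
    ([affine_rep_no_sl2]), hence the dimension is between 2 and 5.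

    Otherwise [I] lies on a line [R E]. Applying the same argument to the ideal
    of all elements of [L] on this line gives [D1] with [[T, D1] = a_T D1] and
    [D1 a_T = 0] for every [T] in [L] ([rank_one_generator]). The algebra of all
    [x D1] with [D1 (D1 x) = 0] is then solvable and normalized by [L], so that
    it is exactly the part of [L] on the line ([second_order_mem]). With
    [F1 = ker D1] it is [F1 D1] if 1 is not a value of [D1], and
    [F1 D1 + F1 b D1] if [D1 b = 1]. Modulo this ideal [L] is a solvable algebra
    of derivations [y D2] of [F1]; the same derived series argument provides [D2]
    such that each [D2 y] lies in [F] ([adapted_exists]), so this quotient is
    spanned over [F] by [D2], or by [D2] and [d D2] with [D2 d = 1]
    ([semidirect_adapted]).

    When the quotient needs a second generator, a preimage [c D1 + d D2] of it can
    be taken with [c = 0]: [D1 c] is in [F1], so [c D1] is in [L]. If [D1 b = 1],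
    evaluating [[D2, D1] = a D1] at [b] gives [D2 b = - a b + a1], which has the
    required form [a b + a1] only for [a = 0]; this is achieved by adding
    [a b D1], an element of [L], to [D2] ([adapted_commuting]). *)

Local Notation span := Defs.span.

(** * Spans and dimension over a subset of the scalars *)

Section Spans.
Variables (R : fieldType) (V : lmodType R) (C : set R).
Implicit Types (U X Y : set V).

Lemma subspace_sum U I (r : seq I) (P : pred I) (f : I -> V) :
  subspace C U -> (forall i, P i -> U (f i)) -> U (\sum_(i <- r | P i) f i).
Proof. by move=> [U0 UD _] Uf; apply: big_ind. Qed.

Lemma span_min U X : subspace C U -> X `<=` U -> span C X `<=` U.
Proof.
move=> sU XU _ [n [c [x [Cc Xx ->]]]].
by apply: (subspace_sum _ sU) => i _; case: sU => _ _; apply=> //; apply: XU.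
Qed.

Lemma sub_span X : C 1 -> X `<=` span C X.
Proof.
move=> C1 x Xx; exists 1%N, (fun=> 1), (fun=> x); split=> //.
by rewrite big_ord1 scale1r.
Qed.

Lemma span_subspace X : (forall c d, C c -> C d -> C (c * d)) ->
  subspace C (span C X).
Proof.
move=> CM; split.
- have f0 (T : Type) (i : 'I_0) : T by case: i.
  by exists 0%N, (f0 _), (f0 _); split=> [[]|[]|] //; rewrite big_ord0.
- move=> _ _ [m [c [x [Cc Xx ->]]]] [n [d [y [Cd Xy ->]]]].
  pose glue T (f : 'I_m -> T) (g : 'I_n -> T) (i : 'I_(m + n)) :=
    match fintype.split i with inl j => f j | inr j => g j end.
  exists (m + n)%N, (glue _ c d), (glue _ x y); split.
  + by move=> i; rewrite /glue; case: fintype.split.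
  + by move=> i; rewrite /glue; case: fintype.split.
  + rewrite big_split_ord /=; congr (_ + _); apply: eq_bigr => i _; rewrite /glue.
      by rewrite (unsplitK (inl i : 'I_m + 'I_n)).
    by rewrite (unsplitK (inr i : 'I_m + 'I_n)).
- move=> a _ Ca [n [c [x [Cc Xx ->]]]].
  exists n, (fun i => a * c i), x; split=> // [i|]; first exact: CM.
  by rewrite scaler_sumr; apply: eq_bigr => i _; rewrite scalerA.
Qed.

Lemma subspaceN U : C (-1) -> subspace C U -> forall x, U x -> U (- x).
Proof. by move=> CN [_ _ UZ] x Ux; rewrite -scaleN1r; apply: UZ. Qed.

Lemma sumset_subspace X Y : subspace C X -> subspace C Y ->
  subspace C (sumset X Y).
Proof.
move=> [X0 XD XZ] [Y0 YD YZ]; split.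
- by exists 0 => //; exists 0 => //; rewrite addr0.
- move=> _ _ [x Xx [y Yy <-]] [x' Xx' [y' Yy' <-]].
  by exists (x + x'); [exact: XD|exists (y + y'); [exact: YD|exact: addrACA]].
- move=> c _ Cc [x Xx [y Yy <-]].
  by exists (c *: x); [exact: XZ|exists (c *: y); [exact: YZ|rewrite scalerDr]].
Qed.

Lemma kernel_subspace U (f : V -> R) : subspace C U ->
    (forall u v, U u -> U v -> f (u + v) = f u + f v) ->
    (forall c u, C c -> U u -> f (c *: u) = c * f u) ->
  C 0 -> subspace C (U `&` [set u | f u = 0]).
Proof.
move=> [U0 UD UZ] fD fZ C0; split=> [|x y [Ux fx] [Uy fy]|c x Cc [Ux fx]].
- by split=> //=; rewrite -(scale0r 0) fZ// mul0r.
- by split; [exact: UD|rewrite /= fD// fx fy addr0].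
- by split; [exact: UZ|rewrite /= fZ// fx mulr0].
Qed.

Definition independent2 (D E : V) := forall x y : R,
  x *: D + y *: E = 0 -> x = 0 /\ y = 0.

Lemma independent2P D E : D != 0 -> (forall x, E <> x *: D) -> independent2 D E.
Proof.
move=> D0 ED x y xyE; have [y0|y0] := eqVneq y 0.
  split=> //; move/eqP: xyE; rewrite y0 scale0r addr0 scaler_eq0 (negPf D0) orbF.
  by move/eqP.
case: (ED (- (y^-1 * x))); apply: (scalerI y0).
by rewrite scalerA mulrN mulrA mulfV// mul1r scaleNr -[y *: E](addKr (x *: D)) xyE addr0.
Qed.

(** A linear form either vanishes on [U], which then equals the kernel, or takes
    the value 1 at some [u], which then completes a basis of the kernel to a
    basis of [U]. The boolean records which of the two happened. *)
Lemma has_dim_of_kernel U (f : V -> R) n :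
    C 0 -> C (-1) -> (forall c d, C c -> C d -> C (c * d)) ->
    (forall c, C c -> C c^-1) -> subspace C U -> (forall u, U u -> C (f u)) ->
    (forall u v, U u -> U v -> f (u + v) = f u + f v) ->
    (forall c u, C c -> U u -> f (c *: u) = c * f u) ->
    has_dim C (U `&` [set u | f u = 0]) n ->
  exists b : bool, has_dim C U (n + b) /\ (b -> exists2 u, U u & f u = 1).
Proof.
move=> C0 CN1 CM CV sU Cf fD fZ [e [eI Ue]]; have [U0 UD UZ] := sU.
have [f0|] := pselect (forall u, U u -> f u = 0).
  exists false; rewrite addn0; split=> //; exists e; split=> //; rewrite -Ue.
  by apply/seteqP; split=> [u Uu|u []//]; split=> //; apply: f0.
move/existsNP => [w /not_implyP[Uw /eqP fw]].
set u := (f w)^-1 *: w.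
have Uu : U u by apply: UZ => //; apply/CV/Cf.
have fu : f u = 1 by rewrite fZ ?mulVf//; apply/CV/Cf.
exists true; split=> [|_]; last by exists u.
rewrite addn1; exists (fun i => if unlift ord0 i is Some j then e j else u).
have Ke i : (U `&` [set u | f u = 0]) (e i).
  by rewrite Ue; apply: sub_span => //; have := CM _ _ CN1 CN1; rewrite mulrNN mulr1.
have sumE (c : 'I_n.+1 -> R) :
    \sum_(i < n.+1) c i *: (if unlift ord0 i is Some j then e j else u) =
    c ord0 *: u + \sum_(i < n) c (lift ord0 i) *: e i.
  rewrite big_ord_recl unlift_none; congr (_ + _).
  by apply: eq_bigr => i _; rewrite liftK.
have sK := kernel_subspace sU fD fZ C0.
split=> [c Cc|].
  rewrite sumE => c0.
  have Ksum : (U `&` [set u | f u = 0]) (\sum_(i < n) c (lift ord0 i) *: e i).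
    by apply: subspace_sum => // i _; case: sK => _ _; apply.
  have c00 : c ord0 = 0.
    have [Us fs] := Ksum; have := congr1 f c0; clearbody u.
    rewrite fD//; last exact: UZ.
    rewrite fZ// fu mulr1 [X in _ + X]fs addr0 => ->.
    by rewrite -(scale0r 0) fZ// mul0r.
  move=> i; case: (unliftP ord0 i) => [j|] -> //.
  apply: (eI (fun j => c (lift ord0 j))) => //.
  by rewrite -[RHS]c0 c00 scale0r add0r.
apply/seteqP; split=> [v Uv|]; last first.
  apply: span_min => // _ [i _ <-].
  by case: unliftP => [j|] _ //; case: (Ke j).
have Kv : (U `&` [set u | f u = 0]) (v - f v *: u).
  have UN : U (- f v *: u) by apply: UZ => //; rewrite -mulN1r; apply/CM/Cf.
  rewrite -scaleNr; split; first exact: UD.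
  rewrite /= fD// fZ//; last by rewrite -mulN1r; apply/CM/Cf.
  by rewrite fu mulr1 subrr.
move: Kv; rewrite Ue => -[m [c [x [Cc xe vE]]]].
rewrite -(subrK (f v *: u) v) vE; have [S0 SD SZ] := @span_subspace (range
  (fun i => if unlift ord0 i is Some j then e j else u)) CM.
have C1 : C 1 by have := CM _ _ CN1 CN1; rewrite mulrNN mulr1.
apply: SD; last first.
  by apply: SZ; [exact: Cf|apply: sub_span => //; exists ord0; rewrite ?unlift_none].
apply: subspace_sum => [|i _]; first exact: span_subspace.
apply: SZ => //; have [j _ <-] := xe i.
by apply: sub_span => //; exists (lift ord0 j); rewrite ?liftK.
Qed.

End Spans.

Lemma subspace_sub (R : fieldType) (C C' : set R) (V : lmodType R) (U : set V) :
  C `<=` C' -> subspace C' U -> subspace C U.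
Proof. by move=> sC [U0 UD UZ]; split=> // c D /sC; apply: UZ. Qed.

(** * Derivations of a field and their commutators *)

Section Derivations.
Variable R : fieldType.
Local Notation V := (R -> R^o).
Implicit Types (D E T : V) (r s : R).

Definition commutator D E : V := fun x => D (E x) - E (D x).

Definition derivation D : Prop :=
  (forall x y, D (x + y) = D x + D y) /\
  (forall x y, D (x * y) = D x * y + x * D y).

Lemma der0 D : derivation D -> D 0 = 0.
Proof. by case=> DD _; apply: (addrI (D 0)); rewrite -DD !addr0. Qed.

Lemma derN D r : derivation D -> D (- r) = - D r.
Proof.
move=> dD; apply: (addrI (D r)); case: (dD) => <- _.
by rewrite !subrr der0.
Qed.

Lemma der1 D : derivation D -> D 1 = 0.
Proof.
case=> _ DM; apply: (addrI (D 1)); rewrite addr0.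
by rewrite -{3}(mulr1 1) DM mulr1 mul1r.
Qed.

Lemma derV D r : derivation D -> D r = 0 -> D r^-1 = 0.
Proof.
move=> dD Dr; have [->|r0] := eqVneq r 0; first by rewrite invr0 der0.
have := dD.2 r r^-1; rewrite mulfV// der1// Dr mul0r add0r => /esym/eqP.
by rewrite mulf_eq0 (negPf r0) => /eqP.
Qed.

Lemma derivation0 : derivation (0 : V).
Proof.
split=> x y; first by change (0 = 0 + 0 :> R); rewrite addr0.
by change (0 = 0 * y + x * 0 :> R); rewrite mul0r mulr0 addr0.
Qed.

Lemma derivationD D E : derivation D -> derivation E -> derivation (D + E).
Proof.
move=> [DD DM] [ED EM]; split=> x y; rewrite !fctE.
  by rewrite DD ED addrACA.
by rewrite DM EM mulrDl mulrDr addrACA.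
Qed.

Lemma derivationZ r D : derivation D -> derivation (r *: D).
Proof.
move=> [DD DM]; split=> x y; rewrite !fctE /=.
  by rewrite DD scalerDr.
rewrite DM /GRing.scale /=; ring.
Qed.

Lemma commutatorDr T D E : derivation T ->
  commutator T (D + E) = commutator T D + commutator T E.
Proof.
by case=> TD _; apply/funext => x; rewrite /commutator !fctE TD opprD addrACA.
Qed.

Lemma commutatorN D E : commutator D E = - commutator E D.
Proof. by apply/funext => x; rewrite !fctE /commutator opprB. Qed.

Lemma commutatorDl T D E : derivation T ->
  commutator (D + E) T = commutator D T + commutator E T.
Proof.
by move=> dT; rewrite commutatorN commutatorDr// opprD -!commutatorN.
Qed.

Lemma commutatorZr r T D : derivation T ->
  commutator T (r *: D) = T r *: D + r *: commutator T D.
Proof.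
move=> [_ TM]; apply/funext => x; rewrite /commutator !fctE /GRing.scale /=.
rewrite TM; ring.
Qed.

Lemma commutatorZl r T D : derivation T ->
  commutator (r *: D) T = - T r *: D + r *: commutator D T.
Proof.
by move=> dT; rewrite commutatorN commutatorZr// opprD -scaleNr -scalerN -commutatorN.
Qed.

Lemma commutator_self D : commutator D D = 0.
Proof. by apply/funext => x; rewrite /commutator subrr. Qed.

Lemma commutator_jacobi D E T : derivation D -> derivation E -> derivation T ->
  commutator D (commutator E T) =
  commutator (commutator D E) T + commutator E (commutator D T).
Proof.
move=> dD dE dT; apply/funext => x; rewrite !fctE /commutator.
rewrite !(dD.1, dE.1, dT.1) !(derN _ dD, derN _ dE, derN _ dT); ring.
Qed.

Lemma commutator_cyclic D E T : derivation D -> derivation E -> derivation T ->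
  commutator D (commutator E T) + commutator E (commutator T D)
    + commutator T (commutator D E) = 0.
Proof.
move=> dD dE dT; apply/funext => x; rewrite !fctE /commutator.
rewrite !(dD.1, dE.1, dT.1) !(derN _ dD, derN _ dE, derN _ dT).
by transitivity (0 : R); first ring.
Qed.

End Derivations.

(** * Constants of a set of derivations *)

Section ConstantsOfSets.
Variable R : fieldType.
Local Notation V := (R -> R^o).
Implicit Types (L X : set V) (D E T : V) (c : R).

Definition consts L : set R := [set r | forall D, L D -> D r = 0].

Definition derivations L : Prop := forall D, L D -> derivation D.

Variable L : set V.
Hypothesis dL : derivations L.
Local Notation F := (consts L).

Lemma consts1 : F 1. Proof. by move=> D /dL/der1. Qed.

Lemma constsN1 : F (-1).
Proof. by move=> D /dL dD; rewrite derN// der1// oppr0. Qed.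

Lemma constsM c d : F c -> F d -> F (c * d).
Proof. by move=> Fc Fd D LD; rewrite (dL LD).2 (Fc D)// (Fd D)// mul0r mulr0 addr0. Qed.

Lemma constsD c d : F c -> F d -> F (c + d).
Proof. by move=> Fc Fd D LD; rewrite (dL LD).1 (Fc D)// (Fd D)// addr0. Qed.

Lemma consts0 : F 0. Proof. by move=> D /dL/der0. Qed.

Lemma constsN c : F c -> F (- c).
Proof. by rewrite -mulN1r; apply: constsM; exact: constsN1. Qed.

Lemma constsB c d : F c -> F d -> F (c - d).
Proof. by move=> Fc Fd; apply/constsD/constsN. Qed.

Lemma constsV c : F c -> F c^-1.
Proof. by move=> Fc D LD; apply: derV (dL LD) _; apply: Fc. Qed.

Lemma span_derivations : derivations (span setT L).
Proof.
apply: span_min => //; split; first exact: derivation0.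
  exact: derivationD.
by move=> c D _; apply: derivationZ.
Qed.

Lemma span_consts D c : span setT L D -> F c -> D c = 0.
Proof.
move=> LD Fc; suff: span setT L `<=` [set D | D c = 0] by apply.
apply: span_min => [|E /Fc//]; split=> //= [E E' Ec E'c|r E _ Ec].
  by rewrite !fctE Ec E'c addr0.
by rewrite !fctE Ec scaler0.
Qed.

End ConstantsOfSets.

(** * Derived series *)

Section DerivedSeries.
Variables (R : fieldType) (k : set R).
Local Notation V := (R -> R^o).
Local Notation comm := (@commutator R).
Hypotheses (k1 : k 1) (kM : forall c d, k c -> k d -> k (c * d)).
Implicit Types (L M N P X Y U : set V) (D E T : V).

Lemma derived_subspace X : subspace k (derived k comm X).
Proof. exact: span_subspace. Qed.

Lemma mem_derived X D E : X D -> X E -> derived k comm X (comm D E).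
Proof. by move=> XD XE; apply: sub_span => //; exists D => //; exists E. Qed.

Lemma derived_min X U : subspace k U ->
  (forall D E, X D -> X E -> U (comm D E)) -> derived k comm X `<=` U.
Proof.
by move=> sU XU; apply: span_min => // _ [D XD [E XE <-]]; apply: XU.
Qed.

Lemma derivedS X Y : X `<=` Y -> derived k comm X `<=` derived k comm Y.
Proof.
move=> XY; apply: derived_min; first exact: derived_subspace.
by move=> D E /XY YD /XY YE; apply: mem_derived.
Qed.

Lemma iter_derivedS n X Y : X `<=` Y ->
  iter n (derived k comm) X `<=` iter n (derived k comm) Y.
Proof. by move=> XY; elim: n => //= n; apply: derivedS. Qed.

Lemma lie_solvableP X : X 0 ->
  lie_solvable k comm X <-> exists n, iter n (derived k comm) X `<=` [set 0].
Proof.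
move=> X0; split=> [[n Xn]|[n Xn]]; exists n; first by rewrite Xn.
apply/seteqP; split=> // _ ->.
by case: n {Xn} => //= n; case: (derived_subspace (iter n (derived k comm) X)).
Qed.

Lemma derived_sub L : lie_subalgebra k comm L -> derived k comm L `<=` L.
Proof. by case=> sL cL; apply: derived_min. Qed.

(** Modulo an ideal [N] the derived series of [L + N] is that of [L]; hence an
    extension of a solvable algebra by a solvable ideal is solvable. *)
Lemma lie_solvable_sum L N : derivations L -> derivations N ->
  lie_subalgebra k comm L -> lie_subalgebra k comm N ->
  (forall T D, L T -> N D -> N (comm T D)) ->
  (forall T D, L T -> N D -> N (comm D T)) ->
  lie_solvable k comm L -> lie_solvable k comm N ->
  lie_solvable k comm (sumset L N).
Proof.
move=> dL dN [sL cL] [sN cN] LN NL /lie_solvableP [|n Ln]; first by case: sL.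
move=> /lie_solvableP [|m Nm]; first by case: sN.
have subL j : iter j (derived k comm) L `<=` L.
  elim: j => //= j IH; apply: subset_trans (derived_sub (conj sL cL)).
  exact: derivedS.
have sLj j : subspace k (iter j (derived k comm) L).
  by case: j => //= j; apply: derived_subspace.
have step j : iter j (derived k comm) (sumset L N) `<=`
    sumset (iter j (derived k comm) L) N.
  elim: j => //= j IH; apply: derived_min.
    by apply: sumset_subspace => //; apply: derived_subspace.
  move=> _ _ /IH[D LD [D' ND' <-]] /IH[E LE [E' NE' <-]].
  have [LD0 LE0] := (subL _ _ LD, subL _ _ LE).
  have [dD dD' dE dE'] := And4 (dL _ LD0) (dN _ ND') (dL _ LE0) (dN _ NE').
  exists (comm D E); first exact: mem_derived.
  exists (comm D E' + comm D' (E + E')).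
    case: sN => _ ND _; rewrite (commutatorDr _ _ dD').
    by apply: (ND); [exact: LN|apply: (ND); [exact: NL|exact: cN]].
  rewrite (commutatorDl _ _ (derivationD dE dE')) (commutatorDr _ _ dD).
  by rewrite addrA.
have stop : iter n (derived k comm) (sumset L N) `<=` N.
  by move=> _ /step[D /Ln -> [E NE <-]]; rewrite add0r.
apply/lie_solvableP; first by case: (sumset_subspace sL sN).
exists (m + n)%N; rewrite iterD.
exact: subset_trans (iter_derivedS stop) Nm.
Qed.

End DerivedSeries.

(** * Maximal solvable algebras: scalars, absorption, abelian ideals *)

Section MaximalSolvable.
Variables (R : fieldType) (k : set R).
Local Notation V := (R -> R^o).
Local Notation comm := (@commutator R).
Variable L : set V.
Local Notation F := (consts L).
Local Notation RL := (span setT L).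
Hypotheses (k1 : k 1) (kN1 : k (-1)) (kM : forall c d, k c -> k d -> k (c * d)).
Hypothesis kF : k `<=` F.
Hypotheses (dL : derivations L) (lieL : lie_subalgebra k comm L).
Hypothesis solL : lie_solvable k comm L.
(** Maximality is only ever applied to algebras inside [RL]; those containing [L]
    have the same rank as [L]. *)
Hypothesis maxL : forall M : set V, L `<=` M -> M `<=` RL ->
  lie_subalgebra k comm M -> lie_solvable k comm M -> M `<=` L.
Implicit Types (N P X U : set V) (D E T : V).

Lemma RL_sub : L `<=` RL. Proof. exact: sub_span. Qed.
Hint Resolve RL_sub : core.

Lemma RL_subspace (C : set R) : subspace C RL.
Proof.
have [|RL0 RLD RLZ] := @span_subspace R V setT L; first by [].
by split=> // c D _; apply: RLZ.
Qed.

Let dRL : derivations RL := span_derivations dL.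

(** The commutator is [F]-bilinear on the [F]-span of a part of [L], even though
    it is far from bilinear over [R]. *)
Lemma span_comm X U : X `<=` L -> subspace F U ->
  (forall D E, X D -> X E -> U (comm D E)) ->
  forall D E, span F X D -> span F X E -> U (comm D E).
Proof.
move=> XL [U0 UD UZ] XU.
have [RL0 RLD RLZ] := RL_subspace F.
have left E : X E -> span F X `<=` [set D | RL D /\ U (comm D E)].
  move=> XE; have LE := XL _ XE; have dE := dL LE; apply: span_min.
    split.
    - split=> //; rewrite -(scale0r 0) commutatorZl// der0// oppr0.
      by rewrite !scale0r addr0.
    - move=> D D' [RD UDE] [RD' UDE']; split; first exact: RLD.
      by rewrite commutatorDl//; apply: UD.
    - move=> c D Fc [RD UDE]; split; first exact: RLZ.
      by rewrite commutatorZl// (Fc _ LE) oppr0 scale0r add0r; apply: UZ.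
  by move=> D XD; split; [exact/RL_sub/XL|exact: XU].
move=> D E sD.
suff right : span F X `<=` [set E | RL E /\ U (comm D E)] by case/right.
have RD : RL D by apply: span_min sD => //; apply: subset_trans XL _.
have dD := dRL RD; apply: span_min.
  split.
  - by split=> //; rewrite -(scale0r 0) commutatorZr// der0// !scale0r addr0.
  - move=> D1 D2 [RD1 UD1] [RD2 UD2]; split; first exact: RLD.
    by rewrite commutatorDr//; apply: UD.
  - move=> c D1 Fc [RD1 UD1]; split; first exact: RLZ.
    by rewrite commutatorZr// (span_consts RD Fc) scale0r add0r; apply: UZ.
by move=> D1 XD1; split; [exact/RL_sub/XL|case: (left _ XD1 _ sD)].
Qed.

(** Extending scalars from [k] to [F] commutes with forming derived algebras,
    so [F L] is again solvable and maximality forces [F L = L]. *)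
Lemma maximal_subspace : subspace F L.
Proof.
have FM := @constsM _ _ dL.
have sFX X : subspace F (span F X) by apply: span_subspace.
have subL n : iter n (derived k comm) L `<=` L.
  elim: n => //= n IH; apply: subset_trans (derived_sub lieL).
  exact: derivedS.
suff FL : span F L `<=` L.
  have [L0 LD _] := lieL.1; split=> // c D Fc LD'; apply: FL.
  by have [_ _] := sFX L; apply=> //; apply: sub_span => //; apply: consts1.
apply: maxL.
- by apply: sub_span; apply: consts1.
- by apply: span_min; [exact: RL_subspace|exact: RL_sub].
- split; first exact: subspace_sub (sFX L).
  apply: span_comm => // D E LD LE; apply: sub_span; first exact: consts1.
  exact: lieL.2.
have [L0 _ _] := lieL.1.
have [n Ln] := (lie_solvableP kM L0).1 solL.
apply/(lie_solvableP kM); first by case: (sFX L).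
exists n; suff step j : iter j (derived k comm) (span F L) `<=`
    span F (iter j (derived k comm) L).
  apply: subset_trans (step n) _; apply: span_min => //.
  by split=> // [x y -> ->|c x _ ->]; rewrite ?addr0 ?scaler0.
elim: j => //= j IH; apply: derived_min; first exact: subspace_sub (sFX _).
move=> D E /IH sD /IH sE; move: sD sE; apply: span_comm => //.
move=> D' E' XD XE; apply: sub_span; first exact: consts1.
exact: mem_derived.
Qed.

(** The sum of [L] and [N] is an extension of a solvable algebra by the solvable
    ideal [N], so maximality applies to it. *)
Lemma maximal_absorbs N : N `<=` RL -> lie_subalgebra k comm N ->
  (forall T D, L T -> N D -> N (comm T D)) -> lie_solvable k comm N -> N `<=` L.
Proof.
move=> NRL lieN LN solN.
have NL T D : L T -> N D -> N (comm D T).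
  move=> LT ND; rewrite commutatorN; apply: (subspaceN kN1 lieN.1); exact: LN.
have dN : derivations N by move=> D /NRL/dRL.
have [N0 _ _] := lieN.1; have [L0 _ _] := lieL.1.
suff: sumset L N `<=` L.
  by apply: subset_trans => D ND; exists 0 => //; exists D; rewrite ?add0r.
apply: maxL.
- by move=> D LD; exists D => //; exists 0; rewrite ?addr0.
- move=> _ [D LD [E NE <-]]; have [_ RLD _] := RL_subspace setT.
  by apply: RLD; [exact: RL_sub|exact: NRL].
- split; first by apply: sumset_subspace; [exact: lieL.1|exact: lieN.1].
  move=> _ _ [D LD [D' ND' <-]] [E LE [E' NE' <-]].
  have dDE : derivation (E + E') by apply: derivationD; [exact: dL|exact: dN].
  exists (comm D E); first exact: lieL.2.
  exists (comm D E' + comm D' (E + E')).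
    have [_ ND _] := lieN.1; rewrite (commutatorDr _ _ (dN _ ND')).
    by apply: (ND); [exact: LN|apply: (ND); [exact: NL|exact: lieN.2]].
  rewrite (commutatorDl _ _ dDE) (commutatorDr _ _ (dL LD)).
  by rewrite addrA.
- exact: lie_solvable_sum.
Qed.

Lemma maximal_lie_algebra : is_lie_algebra F comm L.
Proof.
have sL := maximal_subspace; split=> //.
- by split=> //; exact: lieL.2.
- move=> c x y z Fc Lx Ly Lz; have dz := dL Lz.
  by rewrite commutatorDl// commutatorZl// (Fc _ Lz) oppr0 scale0r add0r.
- move=> c x y z Fc Lx Ly Lz; have dz := dL Lz.
  by rewrite commutatorDr// commutatorZr// (Fc _ Lz) scale0r add0r.
- by move=> x _; apply: commutator_self.
- move=> x y z Lx Ly Lz; have [dx dy dz] := And3 (dL Lx) (dL Ly) (dL Lz).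
  exact: commutator_cyclic.
Qed.

(** Although the derived algebra is only a span over [k], scalars of [F] can be
    moved into the brackets, and [P] is stable under them. *)
Lemma derived_ideal P : lie_ideal F comm L P -> lie_ideal F comm L (derived k comm P).
Proof.
move=> [PL sP idP].
have dsub := derived_subspace kM P; have [d0 dD dZ] := dsub.
split.
- apply: derived_min; first exact: lieL.1.
  by move=> D E /PL LD /PL LE; apply: lieL.2.
- split=> // c D Fc.
  suff: derived k comm P `<=` [set D | derived k comm P (c *: D)] by apply.
  apply: derived_min.
    split=> [|D1 D2 P1 P2|r D1 kr P1] /=; first by rewrite scaler0.
      by rewrite scalerDr; apply: dD.
    by rewrite scalerA mulrC -scalerA; apply: dZ.
  move=> D1 D2 P1 P2 /=; have LD2 := PL _ P2.
  suff -> : c *: comm D1 D2 = comm (c *: D1) D2.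
    by apply: mem_derived => //; case: sP => _ _; apply.
  by rewrite (commutatorZl _ _ (dL LD2)) (Fc _ LD2) oppr0 scale0r add0r.
- move=> T D LT; have dT := dL LT.
  suff: derived k comm P `<=` [set D | RL D /\ derived k comm P (comm T D)].
    by move=> /[apply]-[].
  have [RL0 RLD RLZ] := RL_subspace setT.
  apply: derived_min.
    split; first by split=> //; rewrite -(scale0r 0) commutatorZr// der0// !scale0r addr0.
    - move=> D1 D2 [RD1 UD1] [RD2 UD2]; split; first exact: RLD.
      by rewrite commutatorDr//; apply: dD.
    - move=> c D1 kc [RD1 UD1]; split; first exact: RLZ.
      by rewrite commutatorZr// (kF kc LT) scale0r add0r; apply: dZ.
  move=> D1 D2 P1 P2; have [L1 L2] := (PL _ P1, PL _ P2).
  split; first exact/RL_sub/lieL.2.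
  rewrite commutator_jacobi//; [|exact: dL..].
  by apply: dD; apply: mem_derived => //; apply: idP.
Qed.

(** The ideal sought is the last term of the derived series of [P] that is not
    contained in [J]. For [J = 0] it is an abelian ideal, and for an ideal [J] an
    ideal that becomes abelian modulo [J]. *)
Lemma last_derived_ideal P J : lie_ideal F comm L P -> J 0 -> ~ P `<=` J ->
  exists N, [/\ lie_ideal F comm L N, N `<=` P, ~ N `<=` J
    & forall D E, N D -> N E -> J (comm D E)].
Proof.
move=> idP J0 PJ; have [L0 _ _] := lieL.1.
have ideals n : lie_ideal F comm L (iter n (derived k comm) P).
  by elim: n => //= n; apply: derived_ideal.
have ex : exists n, `[< iter n (derived k comm) P `<=` J >].
  have [n Ln] := (lie_solvableP kM L0).1 solL.
  exists n; apply/asboolP; case: idP => PL _ _.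
  by apply: subset_trans (iter_derivedS k1 kM PL) _ => D /Ln ->.
case: (ex_minnP ex) => -[/asboolP//|n /asboolP nJ n_min].
exists (iter n (derived k comm) P); split => //.
- have [PL sP clP] := idP; elim: n {nJ n_min} => //= n IH.
  apply: subset_trans (derivedS k1 kM IH) _; apply: derived_min.
    exact: subspace_sub sP.
  by move=> D E PD PE; apply: clP => //; apply: PL.
- by move=> /asboolP/n_min; rewrite ltnn.
- by move=> D E ND NE; apply: nJ; apply: mem_derived.
Qed.

(** * Rank two *)

Hypothesis rkL : has_dim setT RL 2.

Lemma rank2_basis : exists E1 E2 : V,
  independent2 E1 E2 /\ forall T, RL T -> exists x y : R, T = x *: E1 + y *: E2.
Proof.
have [e [eI RLe]] := rkL; exists (e ord0), (e ord_max); split=> [x y xy0|T].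
  pose c (i : 'I_2) := if i == ord0 then x else y.
  have c0 : forall i, c i = 0.
    apply: eI => //; rewrite big_ord_recl big_ord1 /c eqxx/=.
    by rewrite (_ : lift _ _ = ord_max)//; apply: val_inj.
  by have := (c0 ord0, c0 ord_max); rewrite /c/= => -[].
rewrite RLe; move: T; apply: span_min => [|_ [i _ <-]]; first split.
- by exists 0, 0; rewrite !scale0r addr0.
- move=> _ _ [x [y ->]] [x' [y' ->]]; exists (x + x'), (y + y').
  by rewrite !scalerDl addrACA.
- by move=> c _ _ [x [y ->]]; exists (c * x), (c * y); rewrite scalerDr !scalerA.
case: (unliftP ord0 i) => [j|] ->; last first.
  by exists 1, 0; rewrite scale1r scale0r addr0.
exists 0, 1; rewrite scale1r scale0r add0r; congr e.
by apply: val_inj; rewrite /= ord1.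
Qed.

(** Cramer's rule for the coordinates of [D] and [E] in a basis; the determinant
    is nonzero, since the cofactors would otherwise give a relation. *)
Lemma rank2_span D E : RL D -> RL E -> independent2 D E ->
  forall T, RL T -> exists x y : R, T = x *: D + y *: E.
Proof.
have [E1 [E2 [E12 genE]]] := rank2_basis.
move=> /genE[a [b ->]] /genE[c [d ->]] DE T /genE[x [y ->]].
set delta := a * d - b * c.
have comb (u v : R) : u *: (a *: E1 + b *: E2) + v *: (c *: E1 + d *: E2) =
    (u * a + v * c) *: E1 + (u * b + v * d) *: E2.
  by rewrite !scalerDr !scalerDl !scalerA addrACA.
have [delta0|delta0] := eqVneq delta 0.
  have [|d0 /eqP] := DE d (- b).
    rewrite comb (_ : d * a + _ = delta); last by rewrite /delta; ring.
    by rewrite delta0 (_ : d * b + _ = 0) ?scale0r ?addr0//; ring.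
  rewrite oppr_eq0 => /eqP b0.
  have [|c0 /eqP] := DE c (- a).
    by rewrite comb d0 b0 (_ : c * a + _ = 0) ?mulr0 ?addr0 ?scale0r ?addr0//; ring.
  rewrite oppr_eq0 => /eqP a0.
  have [|/eqP] := DE 1 0; first by rewrite comb a0 b0 !(mulr0, mul0r, addr0) !scale0r addr0.
  by rewrite oner_eq0.
exists ((x * d - y * c) / delta), ((y * a - x * b) / delta); rewrite comb.
by congr (_ *: _ + _ *: _); rewrite /delta; field; exact: delta0.
Qed.

Lemma rank2_exists D : exists2 E, L E & forall x, E <> x *: D.
Proof.
have [E1 [E2 [E12 genE]]] := rank2_basis; apply: contrapT => noE.
have LD T : L T -> exists x : R, T = x *: D.
  move=> LT; apply: contrapT => noX; apply: noE; exists T => // x Tx.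
  by apply: noX; exists x.
have RLD T : RL T -> exists x : R, T = x *: D.
  move: T; apply: span_min => //; split=> [|_ _ [x ->] [y ->]|c _ _ [x ->]].
  - by exists 0; rewrite scale0r.
  - by exists (x + y); rewrite scalerDl.
  - by exists (c * x); rewrite scalerA.
have [e [eI RLe]] := rkL.
have RE i : RL (e i) by rewrite RLe; apply: sub_span.
have [x ex] := RLD _ (RE ord0); have [y ey] := RLD _ (RE ord_max).
pose c (i : 'I_2) := if i == ord0 then y else - x.
have c0 : forall i, c i = 0.
  apply: eI => //; rewrite big_ord_recl big_ord1 /c eqxx/=.
  rewrite (_ : lift _ _ = ord_max); last exact: val_inj.
  by rewrite ex ey !scalerA mulNr scaleNr mulrC subrr.
have := c0 ord_max; rewrite /c/= => /eqP; rewrite oppr_eq0 => /eqP x0.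
have := @eI (fun i => (i == ord0)%:R) (fun=> I).
rewrite big_ord_recl big_ord1 eqxx/= ex x0 !scale0r scaler0 addr0 => /(_ erefl ord0).
by move/eqP; rewrite eqxx oner_eq0.
Qed.

(** * An abelian ideal of rank one *)

Local Notation ker D := [set r : R | D r = 0].
Local Notation mult S D := [set f *: D | f in S].

Lemma consts_basis D E r : RL D -> RL E -> independent2 D E ->
  D r = 0 -> E r = 0 -> F r.
Proof.
move=> RD RE DE Dr Er T /RL_sub/(rank2_span RD RE DE)[x [y ->]].
by rewrite !fctE Dr Er !scaler0 addr0.
Qed.

(** All elements of [L] on the line of [E] form an ideal [J]; [D1] is taken in an
    abelian ideal [N] contained in [J]. For [T] in [L] the bracket [[T, D1]] lies
    in [N], so it is a multiple [a D1] that commutes with [D1], which says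
    [D1 a = 0]. *)
Lemma rank_one_generator I E : lie_ideal F comm L I -> I E -> E != 0 ->
  (forall T, I T -> exists x, T = x *: E) ->
  exists D1, [/\ L D1, D1 != 0 &
    forall T, L T -> exists2 a, D1 a = 0 & comm T D1 = a *: D1].
Proof.
move=> [IL sI idI] IE E0 linE; have sL := maximal_subspace.
have [L0 LD LZ] := sL; have LE := IL _ IE.
pose J : set V := [set T | L T /\ exists x, T = x *: E].
have idJ : lie_ideal F comm L J.
  split=> [T []//||T _ LT [/[swap][[x ->]] LxE]].
    split=> [|_ _ [/[swap][[x ->]] Lx] [/[swap][[y ->]] Ly]|c _ Fc [/[swap][[x ->]] Lx]].
    - by split=> //; exists 0; rewrite scale0r.
    - by split; [exact: LD|exists (x + y); rewrite scalerDl].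
    - by split; [exact: LZ|exists (c * x); rewrite scalerA].
  split; first exact: lieL.2.
  have [y Ty] := linE _ (idI _ _ LT IE).
  exists (T x + x * y); rewrite (commutatorZr _ _ (dL LT)) Ty scalerA.
  by rewrite -scalerDl.
have [//||N [[NL sN idN] NJ N0 abN]] := @last_derived_ideal J [set 0] idJ.
  move=> /(_ E) /= JE; move/eqP: E0; apply; apply: JE; split=> //.
  by exists 1; rewrite scale1r.
have [D1 ND1 D10] : exists2 D, N D & D <> 0.
  apply: contrapT => noD; apply: N0 => D ND; apply: contrapT => D0.
  by apply: noD; exists D.
have [_ [u D1E]] := NJ _ ND1.
have u0 : u != 0 by apply/eqP => u0; apply: D10; rewrite D1E u0 scale0r.
exists D1; split; [exact: NL|exact/eqP|move=> T LT].
have NT := idN _ _ LT ND1; have [_ [v TE]] := NJ _ NT.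
have TD1 : comm T D1 = (v / u) *: D1 by rewrite TE D1E scalerA divfK.
exists (v / u) => //; apply/eqP.
have /eqP := abN _ _ ND1 NT.
rewrite TD1 (commutatorZr _ _ (dL (NL _ ND1))) commutator_self scaler0 addr0.
by rewrite scaler_eq0 => /orP[//|/eqP].
Qed.

Section RankOneIdeal.
Variable D1 : V.
Hypotheses (LD1 : L D1) (D1n0 : D1 != 0).
Hypothesis idD1 : forall T, L T -> exists2 a, D1 a = 0 & comm T D1 = a *: D1.
Local Notation F1 := (ker D1).
Local Notation J := (mult [set x | F1 (D1 x)] D1).

Let dD1 : derivation D1 := dL LD1.

Lemma ker_stable T f : L T -> F1 f -> F1 (T f).
Proof.
move=> LT /= D1f; have [a D1a TD1] := idD1 LT.
have := congr1 (fun D : V => D f) TD1; rewrite !fctE /commutator D1f scaler0.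
rewrite (der0 (dL LT)) sub0r => /eqP.
by rewrite oppr_eq0 => /eqP.
Qed.

(** The elements [x D1] with [D1 (D1 x) = 0] form an algebra, because the
    Wronskian of two such coefficients is killed by [D1]; the same fact makes its
    derived algebra a part of the abelian algebra [F1 D1]. It is normalized by
    [L], so [L] absorbs it. The converse is the hypothesis on [D1] applied to
    [T = x D1]. *)
Lemma second_order_mem x : L (x *: D1) <-> F1 (D1 x).
Proof.
split=> [LxD1|F1x].
  have [a D1a] := idD1 LxD1.
  rewrite commutatorZl// commutator_self scaler0 addr0 => /eqP.
  rewrite -subr_eq0 -scalerBl scaler_eq0 (negPf D1n0) orbF subr_eq0 => /eqP aE.
  by rewrite /= -[D1 x]opprK derN// aE D1a oppr0.
have commJ y z : comm (y *: D1) (z *: D1) = (y * D1 z - z * D1 y) *: D1.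
  rewrite commutatorZr; last exact: derivationZ.
  rewrite commutatorZl// commutator_self scaler0 addr0 scalerA -scalerDl.
  by congr (_ *: _); rewrite !fctE /GRing.scale/=; ring.
have D1_wronskian y z : F1 (D1 y) -> F1 (D1 z) -> D1 (y * D1 z - z * D1 y) = 0.
  move=> /= D1y D1z; rewrite dD1.1 derN// !dD1.2 D1y D1z; ring.
have JRL : J `<=` RL.
  by move=> _ [y _ <-]; have [_ _] := RL_subspace setT; apply=> //; exact: RL_sub.
have sJ : subspace k J.
  split=> [|_ _ [y D1y <-] [z D1z <-]|c _ kc [y D1y <-]].
  - by exists 0; rewrite ?scale0r//= !der0.
  - by exists (y + z); rewrite ?scalerDl//= dD1.1 dD1.1 D1y D1z addr0.
  - exists (c * y); rewrite ?scalerA//= dD1.2 (kF kc LD1) mul0r add0r dD1.2.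
    by rewrite (kF kc LD1) D1y mul0r mulr0 addr0.
suff /(_ (x *: D1)) : J `<=` L by apply; exists x.
apply: maximal_absorbs => //.
- split=> // _ _ [y D1y <-] [z D1z <-]; exists (y * D1 z - z * D1 y) => //=.
  by rewrite D1_wronskian// der0.
- move=> T _ LT [y D1y <-]; have [a D1a TD1] := idD1 LT.
  exists (T y + y * a); last by rewrite commutatorZr ?TD1 ?scalerA ?scalerDl//; exact: dL.
  (* [[T, D1] = a D1] evaluated at [y] *)
  suff D1Ty : D1 (T y) = T (D1 y) - a * D1 y.
    by rewrite /= dD1.1 dD1.2 D1Ty D1a mulr0 addr0 (mulrC a) subrK; exact: ker_stable.
  have := congr1 (fun D : V => D y) TD1; rewrite !fctE /commutator /GRing.scale/= => <-.
  by rewrite opprB addrC subrK.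
- apply/(lie_solvableP kM); first by case: sJ.
  exists 2%N => /=; apply: derived_min => [|D E].
    by split=> // [? ? -> ->|? ? _ ->]; rewrite ?addr0 ?scaler0.
  have abD : derived k comm J `<=` mult F1 D1.
    apply: derived_min; last first.
      move=> _ _ [y D1y <-] [z D1z <-]; exists (y * D1 z - z * D1 y) => //=.
      exact: D1_wronskian.
    split=> [|_ _ [y D1y <-] [z D1z <-]|c _ kc [y D1y <-]].
    - by exists 0; rewrite ?scale0r//= der0.
    - by exists (y + z); rewrite ?scalerDl//= dD1.1 D1y D1z addr0.
    - exists (c * y); rewrite ?scalerA//= dD1.2 (kF kc LD1) D1y.
      by rewrite mul0r mulr0 addr0.
  move=> /abD[y D1y <-] /abD[z D1z <-].
  by rewrite commJ D1y D1z !mulr0 subrr scale0r.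
Qed.

Lemma line_ideal : lie_ideal F comm L J.
Proof.
have [L0 LD LZ] := maximal_subspace.
split=> [_ [x D1x <-]||T _ LT [x D1x <-]]; first exact/second_order_mem.
  split=> [|_ _ [y D1y <-] [z D1z <-]|c _ Fc [y D1y <-]].
  - by exists 0; rewrite ?scale0r//= !der0.
  - exists (y + z); rewrite ?scalerDl//; apply/second_order_mem.
    by rewrite scalerDl; apply: LD; apply/second_order_mem.
  - exists (c * y); rewrite ?scalerA//; apply/second_order_mem.
    by rewrite -scalerA; apply: LZ => //; apply/second_order_mem.
have [a D1a TD1] := idD1 LT.
have TxE : comm T (x *: D1) = (T x + x * a) *: D1.
  by rewrite commutatorZr ?TD1 ?scalerA ?scalerDl//; exact: dL.
exists (T x + x * a) => //; apply/second_order_mem; rewrite -TxE.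
by apply: lieL.2 => //; apply/second_order_mem.
Qed.

(** The condition says that, modulo the elements of [L] on the line of [D1], [L]
    consists of multiples [y D2] with [y] in [F1] whose brackets with [D2] are
    [F]-multiples of [D2]. *)
Definition adapted D2 := [/\ L D2, forall x, D2 <> x *: D1 &
  forall x y, L (x *: D1 + y *: D2) -> [/\ F1 y, F (D2 y) & L (x *: D1)]].

(** [D2] is taken in an ideal [Q] that is abelian modulo [J]. If [x D1 + y D2] is
    in [L], its bracket with [D1] is a multiple of [D1], so [D1 y = 0]; its
    bracket with [D2] is an element of [Q] with [D2]-coordinate [D2 y], and
    bracketing once more with [D2] gives [D2 (D2 y) = 0]. *)
Lemma adapted_exists : exists D2, adapted D2.
Proof.
have [JL sJ idJ] := line_ideal.
have [L0 LD LZ] := maximal_subspace.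
have idLL : lie_ideal F comm L L.
  by split=> //; exact: lieL.2.
have J0 : J 0 by exists 0; rewrite ?scale0r//= !der0.
have LJ : ~ L `<=` J.
  by move=> LJ; have [E /LJ[x _ xE] ED1] := rank2_exists D1; apply: (ED1 x).
have [Q [[QL sQ idQ] _ QJ abQ]] := last_derived_ideal idLL J0 LJ.
have [D2 QD2 D2J] : exists2 D, Q D & ~ J D.
  apply: contrapT => noD; apply: QJ => D QD; apply: contrapT => D0.
  by apply: noD; exists D.
have LD2 := QL _ QD2; have dD2 := dL LD2.
have D2D1 x : D2 <> x *: D1.
  move=> D2x; apply: D2J; exists x => //=.
  by apply/second_order_mem; rewrite -D2x.
have D12 := independent2P D1n0 D2D1.
have Jcoef x y : J (x *: D1 + y *: D2) -> y = 0.
  move=> [z _ /esym/eqP]; rewrite -subr_eq0 addrAC -scalerBl => /eqP.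
  by case/D12.
have [a D1a D2D1E] := idD1 LD2.
have coefs x y : L (x *: D1 + y *: D2) -> F1 y /\ L (x *: D1).
  move=> LT; have [t D1t TD1] := idD1 LT.
  have D1T : comm D1 (x *: D1 + y *: D2) = (D1 x - y * a) *: D1 + D1 y *: D2.
    rewrite commutatorDr// !commutatorZr// commutator_self scaler0 addr0.
    rewrite (commutatorN D1) D2D1E scalerN scalerA scalerBl -addrA.
    by rewrite (addrC (- _)).
  have /D12[/eqP] : (D1 x - y * a + t) *: D1 + D1 y *: D2 = 0; last first.
    rewrite addr_eq0 => /eqP D1x D1y; split=> //; apply/second_order_mem.
    have {}D1x : D1 x = y * a - t by rewrite -D1x addrC subrK.
    by rewrite /= D1x dD1.1 dD1.2 derN// D1t D1y D1a mul0r mulr0 subr0 addr0.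
  by rewrite scalerDl -TD1 commutatorN D1T addrAC subrr.
have D2coef x y : F1 y -> comm D2 (x *: D1 + y *: D2) = (D2 x + x * a) *: D1 + D2 y *: D2.
  move=> D1y; rewrite commutatorDr// !commutatorZr// commutator_self scaler0 addr0.
  by rewrite D2D1E scalerA -scalerDl.
exists D2; split=> // x y LT; have [D1y LxD1] := coefs _ _ LT; split=> //.
have QT := idQ _ _ LT QD2.
have: Q (comm D2 (x *: D1 + y *: D2)).
  rewrite commutatorN; apply: (subspaceN _ sQ) => //; exact: constsN1.
rewrite D2coef// => QT'; have LT' := QL _ QT'; have [D1y' _] := coefs _ _ LT'.
apply: (consts_basis (RL_sub LD1) (RL_sub LD2) D12 D1y').
by have := abQ _ _ QD2 QT'; rewrite D2coef// => /Jcoef.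
Qed.

(** Adding [a b D1] to [D2] cancels [[D2, D1] = a D1]; this element is in [L] since
    [D1 (a b) = a] is in [F1]. *)
Lemma adapted_commuting b D2 : D1 b = 1 -> adapted D2 ->
  exists D2', adapted D2' /\ comm D2' D1 = 0.
Proof.
move=> D1b [LD2 D2D1 D2coef]; have [L0 LD LZ] := maximal_subspace.
have [a D1a D2D1E] := idD1 LD2.
have LabD1 : L ((a * b) *: D1).
  by apply/second_order_mem; rewrite /= dD1.2 D1a mul0r add0r D1b mulr1.
have combE x y : x *: D1 + y *: (D2 + (a * b) *: D1) =
    (x + y * (a * b)) *: D1 + y *: D2.
  by rewrite scalerDr scalerA scalerDl -!addrA (addrC (y *: D2)).
exists (D2 + (a * b) *: D1); split.
  split=> [|x D2x|x y]; first exact: LD.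
    by apply: (D2D1 (x - a * b)); rewrite scalerBl -D2x addrK.
  rewrite combE => LT; have [D1y FD2y _] := D2coef _ _ LT.
  have [_ _ LxD1] := D2coef _ _ LT.
  split=> //; first by rewrite !fctE D1y scaler0 addr0.
  apply/second_order_mem; move/second_order_mem: LxD1.
  by rewrite /= !dD1.1 !dD1.2 D1y D1a D1b !mul0r !add0r mulr1 dD1.2 D1y D1a mul0r mulr0 !addr0.
rewrite commutatorDl// commutatorZl// commutator_self scaler0 addr0 D2D1E.
by rewrite dD1.2 D1a D1b mul0r add0r mulr1 scaleNr subrr.
Qed.

Lemma mult_subspace D : subspace F (mult F D).
Proof.
split=> [|_ _ [y Fy <-] [z Fz <-]|c _ Fc [y Fy <-]].
- by exists 0; [exact: consts0|rewrite scale0r].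
- by exists (y + z); [exact: constsD|rewrite scalerDl].
- by exists (c * y); [exact: constsM|rewrite scalerA].
Qed.

Lemma commutatorZZ D E f g : L D -> L E -> F f -> F g ->
  comm (f *: D) (g *: E) = (f * g) *: comm D E.
Proof.
move=> LD LE Ff Fg; have dE := derivationZ g (dL LE).
rewrite commutatorZl// commutatorZr; last exact: dL.
have -> : (g *: E) f = 0 by rewrite !fctE (Ff _ LE) scaler0.
by rewrite (Fg _ LD) oppr0 !scale0r !add0r scalerA.
Qed.

(** Let [Y] be the set of coefficients [y] for which [y D2] is in [L]. [D2] maps [Y]
    to [F], and an element of [Y] killed by [D2] is in [F]. So [Y] is [F], or
    [F + F d] with [D2 d = 1]. *)
Lemma semidirect_adapted D2 : adapted D2 ->
  semidirect F comm L (mult F D2) J \/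
  exists d, let T := 0 *: D1 + d *: D2 in
    let B := sumset (mult F T) (mult F D2) in
    [/\ F1 d, D2 d = 1, semidirect F comm B (mult F T) (mult F D2)
      & semidirect F comm L B J].
Proof.
move=> [LD2 D2D1 D2coef]; have [L0 LD LZ] := maximal_subspace.
have dD2 := dL LD2; have D12 := independent2P D1n0 D2D1.
have spanL T : L T -> exists x y, T = x *: D1 + y *: D2.
  by move=> /RL_sub/(rank2_span (RL_sub LD1) (RL_sub LD2) D12).
have constsF r : D1 r = 0 -> D2 r = 0 -> F r.
  exact: (consts_basis (RL_sub LD1) (RL_sub LD2) D12).
have idJ := line_ideal.
have sD2 := mult_subspace D2.
have D2L : mult F D2 `<=` L by move=> _ [f Ff <-]; apply: LZ.
have trivJ B : B 0 -> (forall T, B T -> exists y, T = y *: D2) -> J `&` B = [set 0].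
  move=> B0 BD2; apply/seteqP; split=> [T [[x D1x xT] /BD2[y yT]]|_ ->]; last first.
    by split=> //; exists 0; rewrite ?scale0r//= !der0.
  have /D12[x0 _] : x *: D1 + (- y) *: D2 = 0 by rewrite xT yT scaleNr subrr.
  by rewrite -xT x0 scale0r.
have [[x0 [y0 [LT0 /eqP u0]]]|noT] :=
    pselect (exists x y, L (x *: D1 + y *: D2) /\ D2 y <> 0); last first.
  left; split=> //.
  - split=> // _ _ [f Ff <-] [g Fg <-]; rewrite commutatorZZ// commutator_self scaler0.
    by case: sD2.
  - apply/seteqP; split=> [T LT|_ [D [x D1x <-] [_ [f Ff <-] <-]]]; last first.
      by apply: LD; [exact/second_order_mem|exact: LZ].
    have [x [y Txy]] := spanL _ LT; move: LT; rewrite Txy => LT.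
    have [D1y FD2y LxD1] := D2coef _ _ LT.
    exists (x *: D1); first by exists x => //; apply/second_order_mem.
    exists (y *: D2) => //; exists y => //; apply: constsF => //.
    by apply: contrapT => D2y; apply: noT; exists x, y.
  - by apply: trivJ => [|_ [f Ff <-]]; [case: sD2|exists f].
right; have [D1y0 Fu _] := D2coef _ _ LT0.
set u := D2 y0 in u0 Fu; have FVu : F u^-1 by apply: constsV.
set d := u^-1 * y0; exists d; cbv zeta; rewrite scale0r add0r.
set T := d *: D2; set B := sumset _ _.
have D1d : D1 d = 0 by rewrite dD1.2 D1y0 (FVu _ LD1) mul0r mulr0 addr0.
have D2d : D2 d = 1 by rewrite dD2.2 (FVu _ LD2) mul0r add0r mulVf.
have LT : L T.
  have [_ _ Lx0] := D2coef _ _ LT0.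
  rewrite /T -scalerA; apply: LZ => //.
  rewrite -[y0 *: D2](addKr (x0 *: D1)); apply: LD => //.
  by apply: (subspaceN _ maximal_subspace) => //; exact: constsN1.
have commTD2 : comm T D2 = - D2.
  by rewrite commutatorZl// commutator_self scaler0 addr0 D2d scaleN1r.
have sT := mult_subspace T.
have sB : subspace F B by apply: sumset_subspace.
have BL : B `<=` L by move=> _ [_ [f Ff <-] [_ [g Fg <-] <-]]; apply: LD; apply: LZ.
have D2B : mult F D2 `<=` B.
  by move=> D D2D; exists 0; [case: sT|exists D => //; rewrite add0r].
have commB : forall D E, B D -> B E -> mult F D2 (comm D E).
  move=> _ _ [_ [f Ff <-] [_ [g Fg <-] <-]] [_ [f' Ff' <-] [_ [g' Fg' <-] <-]].
  have [dfT dgD] := conj (dL (LZ _ _ Ff LT)) (dL (LZ _ _ Fg LD2)).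
  have [dfT' dgD'] := conj (dL (LZ _ _ Ff' LT)) (dL (LZ _ _ Fg' LD2)).
  rewrite commutatorDl; last exact: derivationD.
  rewrite !commutatorDr// (commutatorZZ LT LT)// (commutatorZZ LT LD2)//.
  rewrite (commutatorZZ LD2 LT)// (commutatorZZ LD2 LD2)//.
  rewrite !commutator_self !scaler0 add0r addr0.
  rewrite (commutatorN D2) commTD2 opprK scalerN.
  case: sD2 => _ DD DZ; apply: DD; last by exists (g * f') => //; apply: constsM.
  by rewrite -scaleNr; exists (- (f * g')) => //; apply/constsN/constsM.
split=> //.
- split=> //.
  + by split=> // D E BD [f Ff <-]; apply: commB => //; apply: D2B; exists f.
  + split=> // _ _ [f Ff <-] [g Fg <-]; rewrite (commutatorZZ LT LT)//.
    by rewrite commutator_self scaler0; case: sT.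
  + by move=> D TD; exists D => //; exists 0; [case: sD2|rewrite addr0].
  + by apply/seteqP; split=> _ [D HD [E HE <-]]; exists E => //; exists D => //; rewrite addrC.
  + apply/seteqP; split=> [_ [[f Ff <-] [g Fg gT]]|_ ->]; last first.
      by split; [case: sD2|case: sT].
    have /D12[_ /eqP] : 0 *: D1 + (g * d - f) *: D2 = 0.
      by rewrite scale0r add0r scalerBl -scalerA gT subrr.
    rewrite subr_eq0 => /eqP gdf; have := Ff _ LD2.
    rewrite -gdf dD2.2 (Fg _ LD2) D2d mul0r add0r mulr1 => ->.
    by rewrite mul0r scale0r.
- split=> //.
  + by split=> // D E BD BE; apply/D2B/commB.
  + apply/seteqP; split=> [E LE|_ [D [x D1x <-] [E /BL LE <-]]]; last first.
      by apply: LD => //; apply/second_order_mem.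
    have [x [y Exy]] := spanL _ LE; move: LE; rewrite Exy => LE.
    have [D1y FD2y LxD1] := D2coef _ _ LE.
    exists (x *: D1); first by exists x => //; apply/second_order_mem.
    exists (y *: D2) => //; exists (D2 y *: T); first by exists (D2 y).
    exists ((y - D2 y * d) *: D2); last by rewrite scalerA -scalerDl addrC subrK.
    exists (y - D2 y * d) => //; apply: constsF.
      by rewrite dD1.1 derN// dD1.2 (FD2y _ LD1) D1y D1d mul0r mulr0 addr0 subr0.
    by rewrite dD2.1 derN// dD2.2 (FD2y _ LD2) D2d mul0r mulr1 add0r subrr.
  + apply: trivJ => [|_ [_ [f Ff <-] [_ [g Fg <-] <-]]]; first by case: sB.
    by exists (f * d + g); rewrite scalerA -scalerDl.
Qed.

Lemma line_ideal_eq_ker : (forall b, D1 b <> 1) -> J = mult F1 D1.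
Proof.
move=> nob; apply/seteqP; split=> _ [x D1x <-]; exists x => //=; last first.
  by rewrite D1x der0.
apply: contrapT => /eqP D1x0; apply: (nob ((D1 x)^-1 * x)).
by rewrite dD1.2 derV// mul0r add0r mulVf.
Qed.

Lemma line_ideal_eq_ker_add b : D1 b = 1 ->
  J = sumset (mult F1 D1) (mult F1 (b *: D1)).
Proof.
move=> D1b; apply/seteqP; split=> [_ [x D1x <-]|_ [_ [f D1f <-] [_ [g D1g <-] <-]]].
  exists ((x - D1 x * b) *: D1).
    exists (x - D1 x * b) => //=.
    by rewrite dD1.1 derN// dD1.2 D1x mul0r add0r D1b mulr1 subrr.
  exists (D1 x *: (b *: D1)); first by exists (D1 x).
  by rewrite scalerA -scalerDl subrK.
exists (f + g * b); last by rewrite scalerDl scalerA.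
by rewrite /= dD1.1 D1f dD1.2 D1g mul0r !add0r D1b mulr1 D1g.
Qed.

End RankOneIdeal.

(** * An abelian ideal of rank two *)

Section AbelianPlane.
Variables (I : set V) (D : 'I_2 -> V).
Hypotheses (idI : lie_ideal F comm L I) (ID : forall i, I (D i)).
Hypothesis abI : forall T E, I T -> I E -> comm T E = 0.
Hypothesis indD : independent2 (D ord0) (D ord_max).
Hypothesis two_neq0 : 2 != 0 :> R.
Local Notation ga := (@ga2_bracket R).

Let LD i : L (D i). Proof. by case: idI => IL _ _; apply: IL. Qed.
Let dD i : derivation (D i) := dL (LD i).
Let FL := maximal_subspace.

Let sum2 (W : nmodType) (f : 'I_2 -> W) : \sum_i f i = f ord0 + f ord_max.
Proof.
by rewrite big_ord_recl big_ord1; congr (_ + f _); apply: val_inj.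
Qed.

Let ord2P (P : 'I_2 -> Prop) : P ord0 -> P ord_max -> forall i, P i.
Proof.
move=> P0 P1 i; case: (unliftP ord0 i) => [j|] -> //.
by rewrite (_ : lift _ _ = ord_max)//; apply: val_inj; rewrite /= ord1.
Qed.

Lemma plane_coordinates : {x : V -> 'I_2 -> R |
  forall T, L T -> T = \sum_i x T i *: D i}.
Proof.
have ex T : {c : 'I_2 -> R | L T -> T = \sum_i c i *: D i}.
  apply: cid; have [LT|nLT] := pselect (L T); last by exists (fun=> 0).
  have [a [b TE]] := rank2_span (RL_sub (LD _)) (RL_sub (LD _)) indD (RL_sub LT).
  by exists (fun i => if i == ord0 then a else b) => _; rewrite sum2.
by exists (fun T => sval (ex T)) => T; apply: svalP (ex T).
Qed.

Let x T i : R := sval plane_coordinates T i.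

Lemma coordE T : L T -> T = \sum_i x T i *: D i.
Proof. exact: (svalP plane_coordinates). Qed.

Lemma coord_unique T (c : 'I_2 -> R) : L T -> T = \sum_i c i *: D i ->
  forall i, x T i = c i.
Proof.
move=> LT; rewrite {1}(coordE LT) !sum2 => /eqP.
rewrite -subr_eq0 opprD addrACA -!scalerBl => /eqP/indD[/eqP+ /eqP].
by rewrite !subr_eq0 => /eqP + /eqP; apply: ord2P.
Qed.

Lemma coordD T E i : L T -> L E -> x (T + E) i = x T i + x E i.
Proof.
move=> LT LE; move: i; apply: coord_unique; first by case: FL => _ + _; apply.
rewrite {1}(coordE LT) {1}(coordE LE) -big_split.
by apply: eq_bigr => i _; rewrite scalerDl.
Qed.

Lemma coordZ c T i : F c -> L T -> x (c *: T) i = c * x T i.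
Proof.
move=> Fc LT; move: i; apply: coord_unique; first by case: FL => _ _; apply.
by rewrite {1}(coordE LT) scaler_sumr; apply: eq_bigr => i _; rewrite scalerA.
Qed.

Lemma comm_coord (T E : V) : L T -> L E ->
  comm T E = \sum_i (T (x E i) *: D i + x E i *: comm T (D i)).
Proof.
move=> LT LE; rewrite {1}(coordE LE) !sum2 commutatorDr; last exact: dL.
by rewrite !commutatorZr//; exact: dL.
Qed.

Lemma comm_plane j T : L T -> comm (D j) T = \sum_i D j (x T i) *: D i.
Proof.
move=> LT; rewrite comm_coord//; apply: eq_bigr => i _.
by rewrite abI// scaler0 addr0.
Qed.

Lemma plane_consts T i : I T -> F (x T i).
Proof.
move=> IT; have LT : L T by case: idI => + _ _; apply.
have Dx j : D j (x T i) = 0.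
  have := comm_plane j LT; rewrite abI// sum2 => /esym/indD[T0 T1].
  by move: i; apply: ord2P.
by apply: (consts_basis (RL_sub (LD _)) (RL_sub (LD _)) indD).
Qed.

(** The derivatives [D j (x T i)] are the coordinates of the bracket of [D j] and
    [T], which lies in the ideal [I]. *)
Lemma jacobian_consts T i j : L T -> F (D j (x T i)).
Proof.
move=> LT; have IDT : I (comm (D j) T).
  have [_ sI IJ] := idI; rewrite commutatorN; apply: (subspaceN _ sI).
    exact: constsN1.
  exact: IJ.
have LDT : L (comm (D j) T) by case: idI => + _ _; apply.
by rewrite -(coord_unique LDT (comm_plane j LT)); apply: plane_consts.
Qed.

Lemma coord_comm T E i : L T -> L E ->
  x (comm T E) i = \sum_j (x T j * D j (x E i) - x E j * D j (x T i)).
Proof.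
move=> LT LE; move: i; apply: coord_unique; first exact: lieL.2.
rewrite comm_coord//.
under eq_bigr do rewrite commutatorN comm_plane//.
have TE i : T (x E i) = x T ord0 * D ord0 (x E i) + x T ord_max * D ord_max (x E i).
  by rewrite {1}(coordE LT) sum2.
rewrite !sum2 !TE; apply/funext => r; rewrite !fctE /GRing.scale /=; ring.
Qed.

(** The elements of [R] with gradient in [F] are the candidates for affine
    functions; modulo [F] they embed into [F^2] by their gradients, but [R] need
    not contain elements with gradients (1, 0) and (0, 1). Whatever the dimension
    of the space of gradients that occur, an [F]-linear evaluation with values in
    [F] exists: subtract from [r] its linear part, written in functions [p j]
    whose gradients span that space. *)
Lemma base_point : {p : 'I_2 -> R | forall r, (forall j, F (D j r)) ->
  F (r - \sum_j D j r * p j)}.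
Proof.
pose affine r := forall j, F (D j r).
have constsD01 r : D ord0 r = 0 -> D ord_max r = 0 -> F r.
  exact: (consts_basis (RL_sub (LD _)) (RL_sub (LD _)) indD).
have DF i c r : F c -> D i (c * r) = c * D i r.
  by move=> Fc; rewrite (dD i).2 (Fc _ (LD i)) mul0r add0r.
have DB i r s : D i (r - s) = D i r - D i s by rewrite (dD i).1 derN.
apply: cid.
(* All gradients are proportional, or two elements have independent gradients;
   Cramer's rule then turns these two into coordinate functions. *)
have [dependent|] := pselect (forall r s, affine r -> affine s ->
    D ord0 r * D ord_max s = D ord0 s * D ord_max r); last first.
  move=> /existsNP[r /existsNP[s /not_implyP[ar /not_implyP[as_ /eqP]]]].
  rewrite -subr_eq0; set delta := _ - _ => delta0.
  have Fdelta : F delta^-1 by apply/constsV/constsB => //; apply: constsM.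
  exists (fun i => if i == ord0 then delta^-1 * (D ord_max s * r - D ord_max r * s)
             else delta^-1 * (D ord0 r * s - D ord0 s * r)) => t at_.
  rewrite sum2 /= opprD addrA.
  apply: constsD01; rewrite !DB !(DF _ _ _ (at_ _)) !(DF _ _ _ Fdelta) !DB;
    rewrite !(DF _ _ _ (ar _)) !(DF _ _ _ (as_ _)).
    rewrite (_ : D ord_max s * _ - _ = delta); last by rewrite /delta; ring.
    rewrite (_ : D ord0 r * _ - _ = 0); last by ring.
    by rewrite mulVf// mulr0 mulr0 mulr1 subrr subr0.
  rewrite (_ : D ord_max s * _ - _ = 0); last by ring.
  by rewrite -/delta mulVf// mulr0 mulr0 mulr1 subr0 subrr.
have [[r [ar /eqP r0]]|const] := pselect (exists r, affine r /\ D ord0 r <> 0).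
  exists (fun i => if i == ord0 then (D ord0 r)^-1 * r else 0) => t at_.
  have FVr : F (D ord0 r)^-1 by apply/constsV/ar.
  rewrite sum2 /= mulr0 addr0.
  apply: constsD01; rewrite DB (DF _ _ _ (at_ _)) (DF _ _ _ FVr).
    by rewrite mulVf// mulr1 subrr.
  by rewrite mulrCA (dependent t r)// mulrA mulVf// mul1r subrr.
have D0affine t : affine t -> D ord0 t = 0.
  by move=> at_; apply: contrapT => Dt; apply: const; exists t.
have [[s [as_ /eqP s0]]|const'] := pselect (exists s, affine s /\ D ord_max s <> 0).
  exists (fun i => if i == ord0 then 0 else (D ord_max s)^-1 * s) => t at_.
  have FVs : F (D ord_max s)^-1 by apply/constsV/as_.
  rewrite sum2 /= mulr0 add0r.
  apply: constsD01; rewrite DB (DF _ _ _ (at_ _)) (DF _ _ _ FVs).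
    by rewrite (D0affine t)// (D0affine s)// !mulr0 subrr.
  by rewrite mulVf// mulr1 subrr.
exists (fun=> 0) => t at_; rewrite big1 ?subr0 => [|i _]; last by rewrite mulr0.
apply: constsD01; first exact: D0affine.
by apply: contrapT => Dt; apply: const'; exists t.
Qed.

Lemma translations_sub v : (forall i, F (v i)) -> L (\sum_i v i *: D i).
Proof.
by move=> Fv; apply: (subspace_sum _ FL) => i _; case: FL => _ _; apply.
Qed.

Let p : 'I_2 -> R := sval base_point.
Let value (r : R) : R := r - \sum_j D j r * p j.

(** Passing from affine vector fields to their Jacobian matrices reverses
    brackets, whence the sign of the linear part. *)
Definition affine_rep (T : V) : 'M[R]_2 * 'cV[R]_2 :=
  (\matrix_(i, j) - D j (x T i), \col_i value (x T i)).

Lemma affine_repD T E : L T -> L E ->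
  affine_rep (T + E) = affine_rep T + affine_rep E.
Proof.
move=> LT LE; congr pair.
  by apply/matrixP => i j; rewrite !mxE coordD// (dD j).1 opprD.
apply/matrixP => i j; rewrite !mxE coordD// /value !sum2 !(dD _).1 opprD.
ring.
Qed.

Lemma affine_repZ c T : F c -> L T -> affine_rep (c *: T) = c *: affine_rep T.
Proof.
move=> Fc LT.
have DZ j r : D j (c * r) = c * D j r by rewrite (dD j).2 (Fc _ (LD j)) mul0r add0r.
congr pair; apply/matrixP => i j; rewrite !mxE coordZ//.
  by rewrite DZ mulrN.
rewrite /value !sum2 !DZ; ring.
Qed.

Lemma affine_rep_comm T E : L T -> L E ->
  affine_rep (comm T E) = ga (affine_rep T) (affine_rep E).
Proof.
move=> LT LE.
have DZ j c r : F c -> D j (r * c) = D j r * c.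
  by move=> Fc; rewrite (dD j).2 (Fc _ (LD j)) mulr0 addr0.
have DZT j l i r : D j (r * D l (x T i)) = D j r * D l (x T i).
  exact/DZ/jacobian_consts.
have DZE j l i r : D j (r * D l (x E i)) = D j r * D l (x E i).
  exact/DZ/jacobian_consts.
congr pair; apply/matrixP => i j; rewrite !mxE coord_comm//.
  rewrite !sum2 !mxE.
  rewrite !((dD j).1, derN _ (dD j), DZT, DZE); ring.
rewrite /value !sum2 !mxE /value !sum2.
rewrite !((dD _).1, derN _ (dD _), DZT, DZE); ring.
Qed.

Lemma affine_rep_inj T E : L T -> L E -> affine_rep T = affine_rep E -> T = E.
Proof.
move=> LT LE [/matrixP TE1 /matrixP TE2]; rewrite (coordE LT) (coordE LE).
apply: eq_bigr => i _; congr (_ *: _).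
have DTE j : D j (x T i) = D j (x E i).
  by have := TE1 i j; rewrite !mxE => /oppr_inj.
have := TE2 i ord0; rewrite !mxE /value !sum2 !DTE; exact: addIr.
Qed.

Lemma affine_rep_ga T : L T -> ga2 F (affine_rep T).
Proof.
move=> LT; have FT i j := jacobian_consts i j LT; split=> i j; rewrite mxE.
  exact: constsN.
by apply: (svalP base_point) => k'.
Qed.

Lemma affine_rep_translation w : ga2_translations F w ->
  exists2 T, L T & affine_rep T = w.
Proof.
case: w => M v [[_ /= Fv] /= ->].
have Lw := @translations_sub (fun i => v i ord0) (fun i => Fv i ord0).
refine (ex_intro2 _ _ _ Lw _).
have xE := coord_unique Lw erefl.
congr pair; apply/matrixP => i j; rewrite !mxE xE.
  by rewrite (Fv _ _ _ (LD j)) oppr0.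
by rewrite /value sum2 !(Fv _ _ _ (LD _)) !mul0r addr0 subr0 (ord1 j).
Qed.

Local Notation S := (affine_rep @` L).

Lemma affine_rep_subspace X : X `<=` L -> subspace F X -> subspace F (affine_rep @` X).
Proof.
move=> XL [X0 XD XZ]; have L0 := XL _ X0; split.
- exists 0 => //; have := affine_repZ (consts0 dL) L0.
  by rewrite !scale0r.
- move=> _ _ [T XT <-] [E XE <-]; exists (T + E); first exact: XD.
  by apply: affine_repD; exact: XL.
- move=> c _ Fc [T XT <-]; exists (c *: T); first exact: XZ.
  by apply: affine_repZ => //; exact: XL.
Qed.

Lemma lie_ideal_iter n : lie_ideal F comm L (iter n (derived k comm) L).
Proof.
by elim: n => [|n IH]; [split=> //; exact: lieL.2|exact: derived_ideal].
Qed.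

Lemma affine_rep_solvable : lie_solvable F ga S.
Proof.
have step n : iter n (derived F ga) S `<=` affine_rep @` iter n (derived k comm) L.
  elim: n => //= n IH; have [dL' sd _] := lie_ideal_iter n.+1.
  apply: span_min; first exact: affine_rep_subspace.
  have [nL _ _] := lie_ideal_iter n.
  move=> _ [_ /IH[T XT <-] [_ /IH[E XE <-] <-]].
  by exists (comm T E); [exact: mem_derived|apply: affine_rep_comm; exact: nL].
have [L0 _ _] := lieL.1; have [n Ln] := (lie_solvableP kM L0).1 solL.
have sS := affine_rep_subspace (fun T LT => LT) FL.
have rep0 : affine_rep 0 = 0.
  by have := affine_repZ (consts0 dL) L0; rewrite !scale0r.
exists n; apply/seteqP; split=> [_ /step[T /Ln -> <-]|_ ->]; first exact: rep0.
case: n {Ln} => [|n]; first by case: sS.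
pose X := iter n (derived F ga) S.
by case: (@span_subspace R _ F [set ga v w | v in X & w in X] (constsM dL)).
Qed.

(** Since [sl_2] is perfect when 2 is invertible, elements of [L] whose linear
    parts are its standard basis survive in every derived algebra. *)
Lemma affine_rep_no_sl2 e f : L e -> L f ->
  (affine_rep e).1 = delta_mx ord0 ord_max ->
  (affine_rep f).1 = delta_mx ord_max ord0 -> False.
Proof.
move=> Le Lf repe repf.
have rep_comm T E : L T -> L E -> (affine_rep (comm T E)).1 =
    (affine_rep T).1 *m (affine_rep E).1 - (affine_rep E).1 *m (affine_rep T).1.
  by move=> LT LE; rewrite affine_rep_comm.
have repZ c T : F c -> L T -> (affine_rep (c *: T)).1 = c *: (affine_rep T).1.
  by move=> Fc LT; rewrite affine_repZ.
have F2 : F 2^-1 by apply/constsV/constsD => //; exact: consts1.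
have triple n : exists e' f' h', let X := iter n (derived k comm) L in
    [/\ X e', X f', X h' &
    [/\ (affine_rep e').1 = delta_mx ord0 ord_max,
        (affine_rep f').1 = delta_mx ord_max ord0 &
        (affine_rep h').1 = delta_mx ord0 ord0 - delta_mx ord_max ord_max]].
  elim: n => [|n [e' [f' [h' [Xe Xf Xh [re rf rh]]]]]].
    exists e, f, (comm e f); split=> //; first exact: lieL.2.
    by split=> //; rewrite rep_comm// repe repf !mul_delta_mx.
  have [XL _ _] := lie_ideal_iter n.
  have [dXL [_ _ dXZ] _] := lie_ideal_iter n.+1.
  (* [[h, e] = 2 e], [[f, h] = 2 f] and [[e, f] = h] in [sl_2] *)
  exists (2^-1 *: comm h' e'), (2^-1 *: comm f' h'), (comm e' f').
  have [Le' Lf' Lh'] := And3 (XL _ Xe) (XL _ Xf) (XL _ Xh).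
  have [Lhe Lfh] := conj (lieL.2 _ _ Lh' Le') (lieL.2 _ _ Lf' Lh').
  split; [by apply: dXZ => //; apply: mem_derived..|exact: mem_derived|].
  have half (M : 'M[R]_2) : 2^-1 *: (M + M) = M.
    by rewrite -mulr2n -scaler_nat scalerA mulVf// scale1r.
  rewrite !repZ// !rep_comm// re rf rh.
  rewrite !(mulmxBl, mulmxBr) !mul_delta_mx !mul_delta_mx_0// !(subr0, sub0r).
  by rewrite !opprK !half.
have [L0 _ _] := lieL.1; have [n Ln] := (lie_solvableP kM L0).1 solL.
have [e' [f' [h' [/Ln -> _ _ [re _ _]]]]] := triple n.
move: re; have := repZ _ _ (consts0 dL) L0; rewrite !scale0r => -> /matrixP.
by move=> /(_ ord0 ord_max) /eqP; rewrite !mxE !eqxx /= eq_sym oner_eq0.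
Qed.

(** Impose successively the vanishing of the four entries of the Jacobian matrix.
    The elements satisfying all four conditions are the [F]-combinations of the
    [D i], and each condition costs at most one dimension. The two off-diagonal
    conditions, imposed last, cannot both cost one: that would produce elements
    of [L] whose linear parts are the nilpotent generators of [sl_2]. *)
Lemma plane_dim : exists2 n, (2 <= n <= 5)%N & has_dim F L n.
Proof.
have F0 := consts0 dL; have FN1 := constsN1 dL.
have FM := @constsM _ _ dL; have FV := @constsV _ _ dL.
pose jac i j (T : V) : R := D j (x T i).
have jacF i j T : L T -> F (jac i j T) by move=> LT; apply: jacobian_consts.
have jacD i j T E : L T -> L E -> jac i j (T + E) = jac i j T + jac i j E.
  by move=> LT LE; rewrite /jac coordD// (dD j).1.
have jacZ i j c T : F c -> L T -> jac i j (c *: T) = c * jac i j T.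
  by move=> Fc LT; rewrite /jac coordZ// (dD j).2 (Fc _ (LD j)) mul0r add0r.
pose good U := U `<=` L /\ subspace F U.
have kerP U i j : good U -> good (U `&` [set T | jac i j T = 0]).
  move=> [UL sU]; split=> [T [/UL]//|]; apply: kernel_subspace => //.
    by move=> T E /UL LT /UL LE; apply: jacD.
  by move=> c T Fc /UL LT; apply: jacZ.
have dim_step U i j n : good U -> has_dim F (U `&` [set T | jac i j T = 0]) n ->
    exists b : bool, has_dim F U (n + b) /\ (b -> exists2 T, U T & jac i j T = 1).
  move=> [UL sU] dimK; apply: (has_dim_of_kernel F0 FN1 FM FV sU _ _ _ dimK).
  - by move=> T /UL; apply: jacF.
  - by move=> T E /UL LT /UL LE; apply: jacD.
  - by move=> c T Fc /UL LT; apply: jacZ.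
pose U1 := L `&` [set T | jac ord0 ord0 T = 0].
pose U2 := U1 `&` [set T | jac ord_max ord_max T = 0].
pose U3 := U2 `&` [set T | jac ord0 ord_max T = 0].
pose U4 := U3 `&` [set T | jac ord_max ord0 T = 0].
have gL : good L by split.
have g1 : good U1 := kerP _ _ _ gL.
have g2 : good U2 := kerP _ _ _ g1.
have g3 : good U3 := kerP _ _ _ g2.
have g4 : good U4 := kerP _ _ _ g3.
have dim4 : has_dim F U4 2.
  exists D; split=> [c Fc|].
    by rewrite sum2 => /indD[c0 c1]; apply: ord2P.
  apply/seteqP; split=> [T [[[[LT j00] j11] j01] j10]|]; last first.
    apply: span_min g4.2 _ => _ [i _ <-].
    have j0 l m : jac l m (D i) = 0 by apply: (plane_consts l (ID i)); exact: LD.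
    by do !split=> //; exact: j0.
  rewrite (coordE LT); apply: subspace_sum; first exact: span_subspace.
  move=> i _; have [_ _ SZ] := @span_subspace _ _ F (range D) FM.
  apply: SZ; last by apply: sub_span => //; exact: consts1.
  move: i; apply: ord2P; apply: (consts_basis (RL_sub (LD _)) (RL_sub (LD _)) indD) => //.
have [b4 [dim3 e4]] := dim_step _ _ _ _ g3 dim4.
have [b3 [dim2 e3]] := dim_step _ _ _ _ g2 dim3.
have [b2 [dim1 _]] := dim_step _ _ _ _ g1 dim2.
have [b1 [dim0 _]] := dim_step _ _ _ _ gL dim1.
exists (2 + b4 + b3 + b2 + b1)%N => //.
suff : ~~ (b3 && b4) by case: b1 b2 b3 b4 {dim0 dim1 dim2 dim3 e3 e4} => [] [] [] [].
(* [v] has lower left entry only; subtracting a multiple of it from [u] leaves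
   the upper right entry only. *)
apply/negP => /andP[/e3[u [[Lu u00] u11] u01] /e4[v [[[Lv v00] v11] v01] v10]].
have [_ LDD LZ] := FL.
have Fc : F (- jac ord_max ord0 u) by apply: constsN => //; exact: jacF.
have Lcv : L (- jac ord_max ord0 u *: v) by apply: LZ.
have Luv : L (u + - jac ord_max ord0 u *: v) by apply: LDD.
have repE T i j : (affine_rep T).1 i j = - jac i j T by rewrite mxE.
have jac_matrix T (M : 'M[R]_2) : (forall i j, - jac i j T = M i j) -> (affine_rep T).1 = M.
  by move=> TM; apply/matrixP => i j; rewrite repE TM.
apply: (@affine_rep_no_sl2 (-1 *: (u + - jac ord_max ord0 u *: v)) (-1 *: v)).
- exact: LZ.
- exact: LZ.
- apply: jac_matrix; do 2!apply: ord2P;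
    rewrite jacZ// jacD// jacZ// mulN1r opprK !mxE /=.
  + by rewrite u00 v00 mulr0 addr0.
  + by rewrite u01 v01 mulr0 addr0.
  + by rewrite v10 mulr1 addrN.
  + by rewrite u11 v11 mulr0 addr0.
- by apply: jac_matrix; do 2!apply: ord2P;
    rewrite jacZ// mulN1r opprK !mxE /=.
Qed.

Lemma abelian_plane_case :
  (exists S : set ('M[R]_2 * 'cV[R]_2),
    [/\ lie_subalgebra F ga S, S `<=` ga2 F, lie_solvable F ga S,
        ga2_translations F `<=` S & lie_isomorphic F comm ga L S]) /\
  exists2 n, (2 <= n <= 5)%N & has_dim F L n.
Proof.
split; last exact: plane_dim.
exists S; split.
- split; first exact: affine_rep_subspace.
  move=> _ _ [T LT <-] [E LE <-]; exists (comm T E); first exact: lieL.2.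
  exact: affine_rep_comm.
- by move=> _ [T LT <-]; apply: affine_rep_ga.
- exact: affine_rep_solvable.
- by move=> w /affine_rep_translation[T LT <-]; exists T.
- exists affine_rep; split; last exact: affine_rep_comm.
  + split=> [T LT|T E /set_mem LT /set_mem LE|w //]; first by exists T.
    exact: affine_rep_inj.
  + exact: affine_repD.
  + by move=> c T Fc LT; apply: affine_repZ.
Qed.

End AbelianPlane.

(** * The five shapes *)

(** In the first alternative [N] is the part of [L] on the line of [D1]. Its two
    possible shapes and the two possible shapes of its complement occur
    independently of each other. *)
Lemma maximal_solvable_cases : 2 != 0 :> R ->
  (exists D1 D2 a, let F1 := ker D1 in
    [/\ L D1, L D2, D1 a = 0, comm D2 D1 = a *: D1 &
    exists N : set V,
      (N = mult F1 D1 \/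
       exists b, [/\ D1 b = 1, a = 0, D1 (D2 b) = 0
         & N = sumset (mult F1 D1) (mult F1 (b *: D1))]) /\
      (semidirect F comm L (mult F D2) N \/
       exists d, let T := 0 *: D1 + d *: D2 in
         let B := sumset (mult F T) (mult F D2) in
         [/\ D1 d = 0, D2 d = 1, semidirect F comm B (mult F T) (mult F D2)
           & semidirect F comm L B N])]) \/
  (exists D1 D2, [/\ L D1, L D2, comm D2 D1 = 0 &
    (exists S : set ('M[R]_2 * 'cV[R]_2),
      [/\ lie_subalgebra F (@ga2_bracket R) S, S `<=` ga2 F,
          lie_solvable F (@ga2_bracket R) S, ga2_translations F `<=` S
        & lie_isomorphic F comm (@ga2_bracket R) L S]) /\
    exists2 n, (2 <= n <= 5)%N & has_dim F L n]).
Proof.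
move=> two_neq0; have [LL _ _] := maximal_subspace.
have idLL : lie_ideal F comm L L.
  by split=> //; [exact: maximal_subspace|exact: lieL.2].
have Lneq0 : ~ L `<=` [set 0].
  by move=> L0; have [E /L0 -> /(_ 0)] := rank2_exists 0; rewrite scaler0.
have [I [idI _ I0 abI]] := @last_derived_ideal L [set 0] idLL erefl Lneq0.
have [IL _ _] := idI.
have [E IE /eqP E0] : exists2 E, I E & E <> 0.
  apply: contrapT => noE; apply: I0 => D ID; apply: contrapT => D0.
  by apply: noE; exists D.
have [lineI|] := pselect (forall T, I T -> exists x, T = x *: E); last first.
  move=> /existsNP[T /not_implyP[IT /forallNP TE]]; right.
  pose D (i : 'I_2) := if i == ord0 then E else T.
  exists E, T; split; [exact: IL|exact: IL|exact: abI|].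
  apply: (@abelian_plane_case I D) => //.
    by move=> i; rewrite /D; case: ifP.
  exact: independent2P.
left; have [D1 [LD1 D1n0 idD1]] := rank_one_generator idI IE E0 lineI.
have dD1 := dL LD1.
have [D2 aD2] := adapted_exists LD1 D1n0 idD1.
have [[b D1b]|nob] := pselect (exists b, D1 b = 1); last first.
  have [LD2 _ _] := aD2; have [a D1a D2D1E] := idD1 _ LD2.
  exists D1, D2, a; split=> //; eexists; split.
    by left; apply: line_ideal_eq_ker => // b D1b; apply: nob; exists b.
  exact: semidirect_adapted.
have [D2' [aD2' D2D1]] := adapted_commuting LD1 D1n0 idD1 D1b aD2.
have [LD2' _ _] := aD2'.
exists D1, D2', 0; split=> //; [exact: der0|by rewrite scale0r|].
eexists; split; last exact: semidirect_adapted aD2'.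
right; exists b; split=> //; last exact: line_ideal_eq_ker_add.
have /(congr1 (fun D : V => D b)) := D2D1; rewrite /commutator D1b.
by rewrite (der1 (dL LD2')) sub0r => /eqP; rewrite oppr_eq0 => /eqP.
Qed.

End MaximalSolvable.

(** * Derivations of a fraction field *)

Section DerivationsOfFractions.
Variables (K : fieldType) (A : idomainAlgType K).
Local Notation R := {fraction A}.
Local Notation k := (@K_scalars K A).

Lemma K_scalars1 : k 1.
Proof. by exists 1 => //; rewrite /K_to_frac scale1r rmorph1. Qed.

Lemma K_scalarsN1 : k (-1).
Proof. by exists (-1) => //; rewrite /K_to_frac scaleN1r rmorphN1. Qed.

Lemma K_scalarsM c d : k c -> k d -> k (c * d).
Proof.
move=> [x _ <-] [y _ <-]; exists (x * y) => //.
by rewrite /K_to_frac -rmorphM -scalerAl mul1r scalerA.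
Qed.

Lemma fraction_two_neq0 : [pchar K] =i pred0 -> 2 != 0 :> R.
Proof.
move=> /pcharf0P K0; have two : (2 : K) != 0 by rewrite K0.
rewrite -[2](rmorph_nat (@tofrac A)) tofrac_eq0.
apply/eqP => A2; have /eqP := @oner_neq0 A; apply.
by rewrite -[1]scale1r -(mulVf two) -scalerA scaler_nat A2 scaler0.
Qed.

Lemma WA_derivation D : @WA K A D -> is_derivation (@K_to_frac K A) D.
Proof.
move: D; apply: span_min => [|D []//]; split.
- split=> [x y|c x|x y]; first by change (0 = 0 + 0 :> R); rewrite addr0.
    by change (0 = K_to_frac A c * 0 :> R); rewrite mulr0.
  by change (0 = 0 * y + x * 0 :> R); rewrite mul0r mulr0 addr0.
- move=> D E [DD DZ DM] [ED EZ EM]; split=> [x y|c x|x y].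
  + exact: (derivationD (conj DD DM) (conj ED EM)).1.
  + by rewrite !fctE DZ EZ mulrDr.
  + exact: (derivationD (conj DD DM) (conj ED EM)).2.
- move=> r D _ [DD DZ DM]; split=> [x y|c x|x y].
  + exact: (derivationZ r (conj DD DM)).1.
  + by rewrite !fctE DZ /GRing.scale /= mulrCA.
  + exact: (derivationZ r (conj DD DM)).2.
Qed.

Lemma WA_subspace : subspace setT (@WA K A).
Proof. exact: span_subspace. Qed.

End DerivationsOfFractions.

Theorem proposition2 (K : fieldType) (charK0 : [pchar K] =i pred0)
    (A : idomainAlgType K) (L : set (fracEnd A))
    (Lmax : maximal_solvable_of_rank 2 L) :
  let F : set {fraction A} := constants L in
  is_lie_algebra F (@bracket K A) L /\
  exists (D1 D2 : fracEnd A) (a : {fraction A}),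
    let F1 : set {fraction A} := der_ker D1 in
    [/\ L D1, L D2, F1 a, bracket D2 D1 = a *: D1 &
    (* 1 *)
    semidirect F (@bracket K A) L (multiples F D2) (multiples F1 D1)
    \/
    (* 2 *)
    (exists b : {fraction A},
      [/\ D1 b = 1,
          exists2 a1, F1 a1 & D2 b = a * b + a1
        & semidirect F (@bracket K A) L (multiples F D2)
            (sumset (multiples F1 D1) (multiples F1 (b *: D1)))])
    \/
    (* 3 *)
    (exists c d : {fraction A},
      let T : fracEnd A := c *: D1 + d *: D2 in
      let B : set (fracEnd A) := sumset (multiples F T) (multiples F D2) in
      [/\ F1 d, F1 (D1 c), D2 d = 1,
          exists2 r, F1 r & D2 c = - a * c + r
        & semidirect F (@bracket K A) B (multiples F T) (multiples F D2) /\
          semidirect F (@bracket K A) L B (multiples F1 D1)])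
    \/
    (* 4 *)
    (exists b c d : {fraction A},
      let T : fracEnd A := c *: D1 + d *: D2 in
      let B : set (fracEnd A) := sumset (multiples F T) (multiples F D2) in
      [/\ D1 b = 1 /\ D2 d = 1,
          F1 d /\ F1 (D1 c),
          exists2 r, F1 r & D2 c = - a * c + r,
          exists2 a1, F1 a1 & D2 b = a * b + a1
        & semidirect F (@bracket K A) B (multiples F T) (multiples F D2) /\
          semidirect F (@bracket K A) L B
            (sumset (multiples F1 D1) (multiples F1 (b *: D1)))])
    \/
    (* 5 *)
    ((exists S : set ('M[{fraction A}]_2 * 'cV[{fraction A}]_2),
       [/\ lie_subalgebra F (@ga2_bracket _) S, S `<=` ga2 F,
           lie_solvable F (@ga2_bracket _) S, ga2_translations F `<=` S
         & lie_isomorphic F (@bracket K A) (@ga2_bracket _) L S]) /\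
     (exists2 n, (2 <= n <= 5)%N & has_dim F L n))].
Proof.
have [[LW lieL solL rkL] maxL] := Lmax.
have dL : derivations L by move=> D /LW/WA_derivation[].
have kF : @K_scalars K A `<=` consts L.
  move=> _ [c _ <-] D LD; have [_ DZ _] := WA_derivation (LW _ LD).
  by rewrite -[K_to_frac A c]mulr1 DZ der1 ?mulr0//; exact: dL.
have k1 := @K_scalars1 K A; have kN1 := @K_scalarsN1 K A.
have kM := @K_scalarsM K A.
have maxL' (M : set (fracEnd A)) : L `<=` M -> M `<=` span setT L ->
    lie_subalgebra (@K_scalars K A) (@commutator _) M ->
    lie_solvable (@K_scalars K A) (@commutator _) M -> M `<=` L.
  move=> LM MRL lieM solM; rewrite (maxL M)//; split=> //.
    by apply: subset_trans MRL _; apply: span_min LW; exact: WA_subspace.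
  rewrite /has_rank (_ : span setT M = span setT L)//.
  apply/seteqP; split; apply: span_min; try exact: span_subspace; first exact: MRL.
  by apply: subset_trans LM _; apply: sub_span.
move=> F; split; first exact: (maximal_lie_algebra k1 kM kF dL lieL solL maxL').
have := maximal_solvable_cases k1 kN1 kM kF dL lieL solL maxL' rkL
  (fraction_two_neq0 A charK0).
case=> [[D1 [D2 [a [LD1 LD2 D1a D2D1 [N [Ncase Bcase]]]]]]|]; last first.
  move=> [D1 [D2 [LD1 LD2 D2D1 ga_case]]].
  exists D1, D2, 0; split=> //; [exact: der0 (dL _ LD1)|by rewrite scale0r|].
  by do 4!right.
exists D1, D2, a; split=> //.
have [dD1 dD2] := conj (dL _ LD1) (dL _ LD2).
have zero_in : exists2 r, der_ker D1 r & D2 0 = - a * 0 + r.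
  by exists 0; [exact: der0|rewrite mulr0 addr0 der0].
have der_zero : der_ker D1 (D1 0) by rewrite /der_ker /= !der0.
case: Ncase Bcase => [-> [|[d [D1d D2d BT LB]]]|[b [D1b a0 D1D2b ->]]].
- by left.
- by do 2!right; left; exists 0, d; split=> //; split.
have D2b : exists2 a1, der_ker D1 a1 & D2 b = a * b + a1.
  by exists (D2 b) => //; rewrite a0 mul0r add0r.
case=> [LB|[d [D1d D2d BT LB]]].
- by right; left; exists b.
- by do 3!right; left; exists b, 0, d; split=> //; split.
Qed.
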